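(* Let $(G,C,C^\vee)$ be a framework for $B$ and let $\mathcal{A}=\mathcal{A}(B,Y,X)$ be a cluster algebra whose initial seed $(B,Y,X)$ has exchange matrix $B$. Then there is a map $\tilde v\mapsto\operatorname{Seed}(\tilde v)=(B^{\tilde v},Y^{\tilde v},X^{\tilde v})$, from vertices of the universal cover $\hat G$ to seeds of $\mathcal{A}$ indexed by $I(\tilde v)$, such that $\operatorname{Seed}(v_b)$ is the initial seed (with $I(v_b)$ identified with $I$), such that whenever $\tilde v,\tilde v'$ are joined by an edge $e$ of $\hat G$ the seed $\operatorname{Seed}(\tilde v')$ is obtained from $\operatorname{Seed}(\tilde v)$ by mutation at $e$ with indices transported by $\mu_e$ (so that $\operatorname{Seed}$ induces a covering of the exchange graph of $\mathcal{A}$ by $\hat G$), and such that for every vertex $\tilde v$ the exchange matrix $B^{\tilde v}=[b^{\tilde v}_{ef}]_{e,f\in I(\tilde v)}$ satisfies $b^{\tilde v}_{ef}=\omega(C^\vee(\tilde v,e),C(\tilde v,f))$.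
   Context: Setting: $I$ finite, $|I|=n$, $B=[b_{ij}]_{i,j\in I}$ skew-symmetrizable integer matrix ($\delta(i)b_{ij}=-\delta(j)b_{ji}$, $\delta>0$); $V$ real vector space with simple roots $\{\alpha_i\}$ as basis, simple co-roots $\alpha_i^\vee=\delta(i)^{-1}\alpha_i$; $\omega$ the bilinear form with $\omega(\alpha_i^\vee,\alpha_j)=b_{ij}$; $[x]_+=\max(x,0)$. Frameworks: quasi-graphs are simple hypergraphs with half-edges (size 1) and full edges (size 2); degree counts all incident edges; connected means connected after discarding half-edges; $I(v)$ = edges containing $v$; $(v,e)$, $e\in I(v)$, is an incident pair. A framework for $B$ is $(G,C,C^\vee)$ with $G$ connected, regular of degree $n$, and vectors $C(v,e),C^\vee(v,e)\in V$ (sets $C(v),C^\vee(v)$; $\beta^\vee:=C^\vee(v,e)$ for $\beta=C(v,e)$) such that: $C^\vee(v,e)$ is a positive multiple of $C(v,e)$; $C(v,e)\neq0$ and $\pm C(v,e)$ is in the nonnegative span of the simple roots (giving $\operatorname{sgn}(C(v,e))=\operatorname{sgn}(C^\vee(v,e))\in\{\pm1\}$); some vertex $v_b$ has $C(v_b)=\{\alpha_i\}$, $C^\vee(v_b)=\{\alpha_i^\vee\}$ (identifying $I(v_b)$ with $I$ via $C(v_b,e)=\alpha_i$); if distinct $v,v'$ lie on an edge $e$ then $C(v',e)=-C(v,e)$, $C^\vee(v',e)=-C^\vee(v,e)$, and for $\beta=C(v,e)$, $\gamma\in C(v)\setminus\{\beta\}$: $\gamma+[\operatorname{sgn}(\beta)\omega(\beta^\vee,\gamma)]_+\beta\in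 C(v')$ and $\gamma^\vee+[-\operatorname{sgn}(\beta^\vee)\omega(\gamma^\vee,\beta)]_+\beta^\vee\in C^\vee(v')$. For a full edge $e$ joining $v,v'$, $\mu_e:I(v)\to I(v')$ has $\mu_e(e)=e$ and for $f\ne e$, $\mu_e(f)$ is the $f'\in I(v')$ with $C(v',f')=C(v,f)+[\operatorname{sgn}(C(v,e))\omega(C^\vee(v,e),C(v,f))]_+C(v,e)$. Universal cover $\hat G$ at $v_b$: vertices are sequences $(u_0,\dots,u_k)$, $k\ge0$, $u_0=v_b$, with $u_{i-1},u_i$ joined by an edge $e_i$ of $G$ and $e_i\ne e_{i+1}$; $(u_0,\dots,u_k)$ is joined to $(u_0,\dots,u_{k-1})$ by a full edge lying over $e_k$, and carries half-edges in a fixed bijection with those at $u_k$. Labels, co-labels and the maps $\mu_e$ are pulled back along $(u_0,\dots,u_k)\mapsto u_k$. Cluster algebras: $\mathbb{P}$ a semifield, $\mathcal{F}$ the field of rational functions in $n$ variables over $\mathbb{Q}\mathbb{P}$. A seed indexed by a set $J$ is $(B',Y',X')$ with $B'$ a skew-symmetrizable integer $J\times J$ matrix, $Y'=(y'_p)$ in $\mathbb{P}$, $X'=(x'_p)$ algebraically independent in $\mathcal{F}$. Mutation at $k\in J$: $b''_{pq}=-b'_{pq}$ if $p=k$ or $q=k$, else $b''_{pq}=b'_{pq}+\operatorname{sgn}(b'_{pk})[b'_{pk}b'_{kq}]_+$; $y''_k=(y'_k)^{-1}$, $y''_p=y'_p(y'_k)^{[b'_{kp}]_+}(y'_k\oplus1)^{-b'_{kp}}$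 for $p\ne k$; $x''_p=x'_p$ for $p\ne k$ and $x''_k=\frac{1}{(y'_k\oplus1)x'_k}\big(y'_k\prod_p(x'_p)^{[b'_{pk}]_+}+\prod_p(x'_p)^{[-b'_{pk}]_+}\big)$. The exchange graph has as vertices seeds reachable by mutation from the initial seed, up to relabeling of indices, with edges given by mutations. *)

(* Defs.v *)
From HB Require Import structures.
From mathcomp Require Import all_boot all_order all_algebra.
From mathcomp Require Import finmap mpoly.
From mathcomp Require Import boolp classical_sets functions cardinality reals.

Set Implicit Arguments.
Unset Strict Implicit.
Unset Printing Implicit Defensive.

Import Order.TTheory GRing.Theory Num.Theory.

Local Open Scope classical_set_scope.
Local Open Scope fset_scope.
Local Open Scope ring_scope.

Definition pos_part (K : numDomainType) (x : K) : K := Num.max x 0.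

(* Several half-edges may hang from the same vertex, so only full edges are
   determined by their endpoints. *)
Record quasi_graph := QuasiGraph {
  vert : choiceType;
  edge : choiceType;
  ends : edge -> {fset vert};
  ends_size : forall e, (0 < #|` ends e| <= 2)%N;
  full_simple : forall e f,
    #|` ends e| = 2%N -> ends e = ends f -> e = f }.

Section QuasiGraphs.
Variable G : quasi_graph.
Implicit Types (u v : vert G) (e : edge G).

Definition full_edge e : bool := #|` ends e| == 2%N.
Definition half_edge e : bool := #|` ends e| == 1%N.

Definition joined e u v : bool := (u != v) && (ends e == [fset u; v]).

Definition incident_edges v : set (edge G) := [set e | v \in ends e].

(* I(v) as a finite set; fset_set is only meaningful on finite sets, which is
   the case in every graph that is regular of finite degree and in its cover. *)
Definition star v : {fset edge G} := fset_set (incident_edges v).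

Definition regular (n : nat) : Prop :=
  forall v, (incident_edges v #= `I_n)%card.

Definition adjacent u v : bool := `[< exists e, joined e u v >].

Definition connected : Prop :=
  forall u v, exists2 s : seq (vert G), path adjacent u s & last u s = v.
End QuasiGraphs.

(* A half-edge may be sent to a full edge (its missing end is then not
   reached), but the edges at v always correspond bijectively to the edges at
   the image of v. Surjectivity on vertices can only be asked when the source
   has no half-edges: a graph reduced to one vertex with n half-edges has
   bijective stars over every n-regular graph. *)
Record covering (G H : quasi_graph)
    (phi : vert G -> vert H) (psi : edge G -> edge H) : Prop := Covering {
  covering_joined : forall e u v, joined e u v ->
    joined (psi e) (phi u) (phi v);
  covering_star : forall v,
    set_bij (incident_edges v) (incident_edges (phi v)) psi;
  covering_surj : (forall e : edge G, full_edge e) ->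
    forall x, exists v, phi v = x }.

Section UniversalCover.
Variables (G : quasi_graph) (vb : vert G).

Definition cover_seq (s : seq (vert G)) : Prop :=
  [/\ (0 < size s)%N,
      nth vb s 0 = vb,
      forall i, (i.+1 < size s)%N ->
        exists e, joined e (nth vb s i) (nth vb s i.+1)
    & forall i e f, (i.+2 < size s)%N ->
        joined e (nth vb s i) (nth vb s i.+1) ->
        joined f (nth vb s i.+1) (nth vb s i.+2) -> e <> f].

Definition cover_vert := {s : seq (vert G) | `[< cover_seq s >]}.

Definition cover_proj (w : cover_vert) : vert G := last vb (val w).

(* An edge of the cover is the pair of its set of ends and of the edge of G
   below it: ({w}, h) for a half-edge h at the end point of w, and
   ({w, w'}, e) where w' extends w by one step along e. *)
Definition cover_edge_pred (x : {fset cover_vert} * edge G) : Prop :=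
  (exists w, [/\ x.1 = [fset w], half_edge x.2 & cover_proj w \in ends x.2])
  \/ (exists w w' u, [/\ val w' = rcons (val w) u, x.1 = [fset w; w']
                       & joined x.2 (cover_proj w) u]).

Definition cover_edge :=
  {x : {fset cover_vert} * edge G | `[< cover_edge_pred x >]}.

Definition cover_ends (e : cover_edge) : {fset cover_vert} := (val e).1.
Definition cover_eproj (e : cover_edge) : edge G := (val e).2.

Lemma cover_ends_size e : (0 < #|` cover_ends e| <= 2)%N.
Proof.
rewrite /cover_ends; case: e => x /= /asboolP [[w [-> _ _]]|].
  by rewrite cardfs1.
by move=> [w [w' [u [_ -> _]]]]; rewrite cardfs2; case: (_ == _).
Qed.

Lemma cover_full_simple e f :
  #|` cover_ends e| = 2%N -> cover_ends e = cover_ends f -> e = f.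
Proof.
rewrite /cover_ends => e2 ef; apply: val_inj; move: e2 ef.
case: e f => [[A a] /= /asboolP pa] [[D b] /= /asboolP pb] /= A2 AD.
subst D; congr (_, _); move: pa pb.
case=> [[w [/= Aw _ _]]|]; first by rewrite Aw cardfs1 in A2.
move=> [w [w' [u [/= ww' Aw aj]]]].
case=> [[z [/= Az _ _]]|]; first by rewrite Az cardfs1 in A2.
move=> [z [z' [u' [/= zz' Az bj]]]].
have [szw szz] : size (val w') = (size (val w)).+1 /\
                 size (val z') = (size (val z)).+1.
  by rewrite /= ww' zz' !size_rcons.
have : w \in A by rewrite Aw !inE eqxx.
have : w' \in A by rewrite Aw !inE eqxx orbT.
rewrite Az !inE => /orP[] /eqP e1 /orP[] /eqP e2.
- by move: szw; rewrite e1 e2 => /n_Sn.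
- by move: szw; rewrite e1 e2 szz => /eqP; rewrite ltn_eqF.
- have uu' : u = u' by move: zz'; rewrite -e1 -e2 ww' => /rcons_inj[].
  rewrite -e2 -uu' in bj.
  move/andP: aj => [wu /eqP ae]; move/andP: bj => [_ /eqP be].
  by apply: full_simple; rewrite ae ?be // cardfs2 wu.
- by move: szw; rewrite e1 e2 => /n_Sn.
Qed.

Lemma cover_seq_base : `[< cover_seq [:: vb] >].
Proof. by apply/asboolP; split. Qed.

Definition cover_base : cover_vert := exist _ [:: vb] cover_seq_base.

Definition universal_cover : quasi_graph :=
  QuasiGraph cover_ends_size cover_full_simple.
End UniversalCover.

Section Frameworks.
Variables (R : realType) (I : finType) (V : vectType R).
Variables (delta : I -> R) (alpha : I -> V) (omega : V -> V -> R).

Definition skew_symmetrized_by (J : finType) (d : J -> R)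
    (B : J -> J -> int) : Prop :=
  (forall i, 0 < d i) /\
  (forall i j, d i * (B i j)%:~R = - (d j * (B j i)%:~R)).

Definition skew_symmetrizable (J : finType) (B : J -> J -> int) : Prop :=
  exists d, skew_symmetrized_by d B.

Definition coroot (i : I) : V := (delta i)^-1 *: alpha i.

Definition bilinear_form : Prop :=
  (forall x, scalar (omega x)) /\ (forall y, scalar (omega^~ y)).

Definition nonneg_span (x : V) : Prop :=
  exists2 c : I -> R, (forall i, 0 <= c i) & x = \sum_i c i *: alpha i.

(* Only used on nonzero x such that x or - x is in the nonnegative span. *)
Definition sgn (x : V) : R := if `[< nonneg_span x >] then 1 else - 1.

Section Labels.
(* C v e and Cv v e are only relevant when v is an end of e. *)
Variables (G : quasi_graph) (C Cv : vert G -> edge G -> V).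

Definition labels (L : vert G -> edge G -> V) (v : vert G) : set V :=
  L v @` incident_edges v.

Record framework (vb : vert G) : Prop := Framework {
  fw_connected : connected G;
  fw_regular : regular G #|I|;
  fw_colabel : forall v e, v \in ends e ->
    exists2 t : R, 0 < t & Cv v e = t *: C v e;
  fw_nonzero : forall v e, v \in ends e -> C v e <> 0;
  fw_sign : forall v e, v \in ends e ->
    nonneg_span (C v e) \/ nonneg_span (- C v e);
  fw_base : labels C vb = range alpha;
  fw_cobase : labels Cv vb = range coroot;
  fw_opp : forall e v v', joined e v v' ->
    C v' e = - C v e /\ Cv v' e = - Cv v e;
  fw_transition : forall e f v v', joined e v v' ->
    v \in ends f -> C v f <> C v e ->
    labels C v'
      (C v f + pos_part (sgn (C v e) * omega (Cv v e) (C v f)) *: C v e);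
  fw_cotransition : forall e f v v', joined e v v' ->
    v \in ends f -> C v f <> C v e ->
    labels Cv v'
      (Cv v f + pos_part (- sgn (Cv v e) * omega (Cv v f) (C v e)) *: Cv v e)
}.

(* f' = mu_e(f), for an edge e joining v and v', f in I(v) and f' in I(v') *)
Definition mu_rel (e : edge G) (v v' : vert G) (f f' : edge G) : Prop :=
  if f == e then f' = e else
  v' \in ends f' /\
  C v' f' = C v f + pos_part (sgn (C v e) * omega (Cv v e) (C v f)) *: C v e.
End Labels.
End Frameworks.

Section Semifields.
Local Open Scope group_scope.

Record semifield (P : groupType) (oplus : P -> P -> P) : Prop := Semifield {
  sf_mulC : forall x y : P, x * y = y * x;
  sf_addA : associative oplus;
  sf_addC : commutative oplus;
  sf_mulDl : forall x y z : P, oplus x y * z = oplus (x * z) (y * z) }.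

Definition gexpz (P : groupType) (x : P) (m : int) : P :=
  match m with Posz k => x ^+ k | Negz k => x ^- k.+1 end.
End Semifields.

Section AmbientField.
Variables (P : groupType) (F : fieldType) (iota : P -> F).

Definition in_ZP (x : F) : Prop :=
  exists (s : seq P) (c : P -> int), x = \sum_(p <- s) (c p)%:~R * iota p.

Definition in_QP (x : F) : Prop :=
  exists a b, [/\ in_ZP a, in_ZP b, b != 0 & x = a / b].

Definition poly_over_QP (n : nat) (p : {mpoly F[n]}) : Prop :=
  forall m, in_QP p@_m.

Definition eval_at (J : finType) (x : J -> F) (p : {mpoly F[#|J|]}) : F :=
  p.@[fun i => x (enum_val i)].

Definition alg_indep (J : finType) (x : J -> F) : Prop :=
  forall p, poly_over_QP p -> eval_at x p = 0 -> p = 0.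

(* F is a field of rational functions in #|I| variables z over QP, the fraction
   field of the group ring ZP: iota embeds ZP in F, z is algebraically
   independent over QP, and F = QP(z). *)
Record ambient_field (I : finType) : Prop := AmbientField {
  iota1 : iota 1%g = 1;
  iotaM : forall p q, iota (p * q)%g = iota p * iota q;
  iota_free : forall (s : seq P) (c : P -> int), uniq s ->
    \sum_(p <- s) (c p)%:~R * iota p = 0 -> forall p, p \in s -> c p = 0;
  ambient_gen : exists z : I -> F, alg_indep z /\
    forall x, exists p q, [/\ poly_over_QP p, poly_over_QP q,
      eval_at z q != 0 & x = eval_at z p / eval_at z q] }.
End AmbientField.

Record seed (P F J : Type) := Seed {
  seed_B : J -> J -> int;
  seed_Y : J -> P;
  seed_X : J -> F }.

Section Seeds.
Variables (R : realType) (P : groupType) (oplus : P -> P -> P).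
Variables (F : fieldType) (iota : P -> F).

Definition is_seed (J : finType) (S : seed P F J) : Prop :=
  skew_symmetrizable R (seed_B S) /\ alg_indep iota (seed_X S).

Section Mutation.
Variables (J : finType) (S : seed P F J) (k : J).
Let b := seed_B S.
Let y := seed_Y S.
Let x := seed_X S.

Definition mutate_B (p q : J) : int :=
  if (p == k) || (q == k) then - b p q
  else b p q + Num.sg (b p k) * pos_part (b p k * b k q).

Definition mutate_Y (p : J) : P :=
  (if p == k then (y k)^-1
   else y p * gexpz (y k) (pos_part (b k p))
            * gexpz (oplus (y k) 1) (- b k p)%R)%g.

Definition mutate_X (p : J) : F :=
  if p == k then
    (iota (oplus (y k) 1%g) * x k)^-1 *
    (iota (y k) * \prod_q x q ^ pos_part (b q k)
     + \prod_q x q ^ pos_part (- b q k))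
  else x p.

Definition mutate : seed P F J := Seed mutate_B mutate_Y mutate_X.
End Mutation.

Definition transported (J K : finType) (m : J -> K)
    (S : seed P F J) (T : seed P F K) : Prop :=
  [/\ bijective m,
      forall p q, seed_B T (m p) (m q) = seed_B S p q,
      forall p, seed_Y T (m p) = seed_Y S p
    & forall p, seed_X T (m p) = seed_X S p].

Section ExchangeGraph.
Variables (I : finType) (S0 : seed P F I).

Inductive reachable : seed P F I -> Prop :=
| reachable_init : reachable S0
| reachable_mutate S k : reachable S -> reachable (mutate S k).

(* A seed up to relabeling is the set of all its relabelings by I. *)
Definition unlabeled (J : finType) (S : seed P F J) : set (seed P F I) :=
  [set T | exists m : J -> I, transported m S T].

Definition exch_vert :=
  {c : set (seed P F I)
    | `[< exists2 S, reachable S & c = unlabeled S >]}.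

Definition exch_edge_pred (A : {fset exch_vert}) : Prop :=
  exists S k c c', [/\ reachable S, val c = unlabeled S,
    val c' = unlabeled (mutate S k) & A = [fset c; c']].

Definition exch_edge := {A : {fset exch_vert} | `[< exch_edge_pred A >]}.

Lemma exch_ends_size (e : exch_edge) : (0 < #|` val e| <= 2)%N.
Proof.
case: e => A /= /asboolP [S [k [c [c' [_ _ _ ->]]]]].
by rewrite cardfs2; case: (_ == _).
Qed.

Lemma exch_full_simple (e f : exch_edge) :
  #|` val e| = 2%N -> val e = val f -> e = f.
Proof. by move=> _; apply: val_inj. Qed.

Definition exchange_graph : quasi_graph :=
  QuasiGraph exch_ends_size exch_full_simple.
End ExchangeGraph.
End Seeds.

Arguments unlabeled {P F} I {J} S.

(* Main.v *)
(** Every vertex of the universal cover carries an identification of [I] with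
    its edges, obtained from the base vertex by composing the maps [mu_e] along
    the path it encodes. The labels at each vertex form a basis of [V], so the
    positive multiple [C^\vee] of a label is carried to the right co-label, and
    since [omega(beta, beta) = 0] the transition rules for labels and co-labels
    turn [omega(C^\vee(e), C(f))] into its matrix mutation, whatever the sign of
    [C(e)]. Mutating along the path thus gives the seeds; going back along an
    edge is again a mutation because mutation is an involution, and [mu_e] in
    one direction inverts [mu_e] in the other.

    Mutation keeps clusters algebraically independent: [x_k * x'_k] is the value
    of a nonzero polynomial in the other variables, and substituting it over
    [X_k] exchanges relations between the two clusters. The same independence
    gives [x'_k <> x_k], hence distinct mutations of a seed are distinct up to
    relabeling, which makes the induced map to the exchange graph a covering. *)

Require Import Defs.
From HB Require Import structures.
From mathcomp Require Import all_boot all_order all_algebra.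
From mathcomp Require Import finmap mpoly ring.
From mathcomp Require Import boolp classical_sets functions cardinality reals.

Set Implicit Arguments.
Unset Strict Implicit.
Unset Printing Implicit Defensive.

Import Order.TTheory GRing.Theory Num.Theory.

Local Open Scope ring_scope.

(** * Polynomials over QP *)

Section RationalCoefficients.
Variables (P : groupType) (F : fieldType) (iota : P -> F).
Hypothesis iota_1 : iota 1%g = 1.
Hypothesis iota_M : forall p q, iota (p * q)%g = iota p * iota q.

(** [in_ZP] attaches one coefficient to each group element, so repeated elements have to be merged
    by adding their coefficients. Lists with repetitions make closure under sums and products
    immediate. *)
Lemma in_ZP_sum (s : seq (int * P)) :
  in_ZP iota (\sum_(a <- s) a.1%:~R * iota a.2).
Proof.
exists (undup (map snd s)), (fun p => \sum_(a <- s | a.2 == p) a.1).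
rewrite [RHS](eq_bigr
  (fun p => \sum_(a <- s | a.2 == p) a.1%:~R * iota a.2)); last first.
  by move=> p _; rewrite rmorph_sum mulr_suml; apply: eq_bigr => a /eqP->.
rewrite (exchange_big_dep xpredT) //= big_seq [RHS]big_seq.
apply: eq_bigr => a a_s; under eq_bigl do rewrite eq_sym.
rewrite -big_filter filter_pred1_uniq ?undup_uniq ?mem_undup ?map_f //.
by rewrite big_seq1.
Qed.

Lemma in_ZPP x : in_ZP iota x <->
  exists s : seq (int * P), x = \sum_(a <- s) a.1%:~R * iota a.2.
Proof.
split=> [[s [c ->]]|[s ->]]; last exact: in_ZP_sum.
by exists [seq (c p, p) | p <- s]; rewrite big_map.
Qed.

Lemma in_ZP_iota p : in_ZP iota (iota p).
Proof.
by apply/in_ZPP; exists [:: (1, p)]; rewrite big_seq1 /= mul1r.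
Qed.

Lemma in_ZPD x y : in_ZP iota x -> in_ZP iota y -> in_ZP iota (x + y).
Proof.
move=> /in_ZPP[s ->] /in_ZPP[t ->].
by apply/in_ZPP; exists (s ++ t); rewrite big_cat.
Qed.

Lemma in_ZPM x y : in_ZP iota x -> in_ZP iota y -> in_ZP iota (x * y).
Proof.
move=> /in_ZPP[s ->] /in_ZPP[t ->]; apply/in_ZPP.
exists [seq (a.1 * b.1, (a.2 * b.2)%g) | a <- s, b <- t].
rewrite big_allpairs_dep big_distrlr /=; apply: eq_bigr => a _.
by apply: eq_bigr => b _; rewrite intrM iota_M; ring.
Qed.

Lemma in_ZP1 : in_ZP iota 1.
Proof. by rewrite -iota_1; apply: in_ZP_iota. Qed.

Lemma in_ZP_int z : in_ZP iota z%:~R.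
Proof.
by apply/in_ZPP; exists [:: (z, 1%g)]; rewrite big_seq1 iota_1 mulr1.
Qed.

Lemma in_QP_of_ZP x : in_ZP iota x -> in_QP iota x.
Proof.
by move=> xZ; exists x, 1; split; rewrite ?divr1 ?oner_eq0 //; apply: in_ZP1.
Qed.

Lemma in_QPD x y : in_QP iota x -> in_QP iota y -> in_QP iota (x + y).
Proof.
move=> [a [b [aZ bZ b0 ->]]] [c [d [cZ dZ d0 ->]]].
exists (a * d + c * b), (b * d); split; rewrite ?addf_div ?mulf_neq0 //.
  by apply: in_ZPD; apply: in_ZPM.
exact: in_ZPM.
Qed.

Lemma in_QPM x y : in_QP iota x -> in_QP iota y -> in_QP iota (x * y).
Proof.
move=> [a [b [aZ bZ b0 ->]]] [c [d [cZ dZ d0 ->]]].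
by exists (a * c), (b * d); split; rewrite ?mulf_div ?mulf_neq0 //; apply: in_ZPM.
Qed.

Lemma in_QP_int z : in_QP iota z%:~R.
Proof. exact/in_QP_of_ZP/in_ZP_int. Qed.

Lemma in_QP_iota p : in_QP iota (iota p).
Proof. exact/in_QP_of_ZP/in_ZP_iota. Qed.

Section PolyOver.
Variable n : nat.
Implicit Types p q : {mpoly F[n]}.

Lemma poly_over_QPX m : poly_over_QP iota ('X_[m] : {mpoly F[n]}).
Proof. by move=> k; rewrite mcoeffX; apply: (in_QP_int (_ == _)). Qed.

Lemma poly_over_QPD p q :
  poly_over_QP iota p -> poly_over_QP iota q -> poly_over_QP iota (p + q).
Proof. by move=> pQ qQ m; rewrite mcoeffD; apply: in_QPD. Qed.

Lemma poly_over_QPM p q :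
  poly_over_QP iota p -> poly_over_QP iota q -> poly_over_QP iota (p * q).
Proof.
move=> pQ qQ m; rewrite mcoeffM.
elim/big_ind: _ => [|x y|k _]; [exact: (in_QP_int 0)|exact: in_QPD|].
exact: in_QPM.
Qed.

Lemma poly_over_QPZ c p :
  in_QP iota c -> poly_over_QP iota p -> poly_over_QP iota (c *: p).
Proof. by move=> cQ pQ m; rewrite mcoeffZ; apply: in_QPM. Qed.

Lemma poly_over_QP_sum (T : Type) (r : seq T) (f : T -> {mpoly F[n]}) :
  (forall i, poly_over_QP iota (f i)) -> poly_over_QP iota (\sum_(i <- r) f i).
Proof.
move=> fQ; elim/big_ind: _ => [|p q|//]; last exact: poly_over_QPD.
by move=> m; rewrite mcoeff0; apply: (in_QP_int 0).
Qed.

Lemma poly_over_QP_prod (T : Type) (r : seq T) (f : T -> {mpoly F[n]}) :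
  (forall i, poly_over_QP iota (f i)) -> poly_over_QP iota (\prod_(i <- r) f i).
Proof.
move=> fQ; elim/big_ind: _ => [|p q|//]; last exact: poly_over_QPM.
by rewrite -mpolyX0; apply: poly_over_QPX.
Qed.

Lemma poly_over_QP_exp p k : poly_over_QP iota p -> poly_over_QP iota (p ^+ k).
Proof.
move=> pQ; elim: k => [|k IH]; last by rewrite exprS; apply: poly_over_QPM.
by rewrite expr0 -mpolyX0; apply: poly_over_QPX.
Qed.
End PolyOver.

Lemma poly_over_QP_comp n k (lq : k.-tuple {mpoly F[n]}) (p : {mpoly F[k]}) :
  (forall i, poly_over_QP iota (tnth lq i)) -> poly_over_QP iota p ->
  poly_over_QP iota (p \mPo lq).
Proof.
move=> lqQ pQ; rewrite comp_mpolyEX; apply: poly_over_QP_sum => m.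
apply: poly_over_QPZ => //; rewrite comp_mpolyX.
by apply: poly_over_QP_prod => i; apply: poly_over_QP_exp.
Qed.

(** Renaming variables along [m] turns a relation of [x \o m] into one of [x], which is therefore
    zero. Renaming back recovers [p]. *)
Lemma alg_indep_reindex (J K : finType) (m : J -> K) (x : K -> F) :
  bijective m -> alg_indep iota x -> alg_indep iota (x \o m).
Proof.
case=> m' mK m'K x_indep p pQ p0.
pose lq := [tuple ('X_(enum_rank (m (enum_val i))) : {mpoly F[#|K|]}) | i < #|J|].
pose lq' := [tuple ('X_(enum_rank (m' (enum_val i))) : {mpoly F[#|J|]}) | i < #|K|].
have q0 : p \mPo lq = 0.
  apply: x_indep.
    apply: poly_over_QP_comp => // i; rewrite tnth_mktuple.
    exact: poly_over_QPX.
  rewrite /eval_at comp_mpoly_meval -[RHS]p0; apply: meval_eq => i.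
  by rewrite tnth_mktuple mevalXU enum_rankK.
rewrite -[LHS]comp_mpoly_id -[RHS](comp_mpoly0 lq') -q0.
rewrite (comp_mpolyEX p) (comp_mpolyEX p lq) raddf_sum /=; apply: eq_bigr => m0 _.
rewrite comp_mpolyZ !comp_mpolyX rmorph_prod; congr (_ *: _).
apply: eq_bigr => i _; rewrite rmorphXn /= !tnth_mktuple comp_mpolyXU.
by rewrite -tnth_nth tnth_mktuple enum_rankK mK enum_valK.
Qed.

Lemma transported_alg_indep (J K : finType) (m : J -> K)
    (S : seed P F J) (T : seed P F K) :
  transported m S T -> alg_indep iota (seed_X T) -> alg_indep iota (seed_X S).
Proof.
move=> [m_bij _ _ mX] T_indep.
have -> : seed_X S = seed_X T \o m by apply/funext => p; rewrite /= mX.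
exact: alg_indep_reindex.
Qed.
End RationalCoefficients.

(** * Mutation of clusters *)

Section Exchange.
Variables (P : groupType) (F : fieldType) (iota : P -> F).
Hypothesis iota_1 : iota 1%g = 1.
Hypothesis iota_M : forall p q, iota (p * q)%g = iota p * iota q.
Variables (J : finType) (k : J).

Definition forget_var (m : 'X_{1..#|J|}) : 'X_{1..#|J|} :=
  [multinom (if i == enum_rank k then 0%N else m i) | i < #|J|].

(* [swap_var N d p] is [X_k ^ d * p] in which [N / X_k] is substituted for
   [X_k], when [d] bounds the degree of [p] in [X_k]. *)
Definition swap_var (N : {mpoly F[#|J|]}) (d : nat) (p : {mpoly F[#|J|]}) :=
  \sum_(m <- msupp p) p@_m *: ('X_[forget_var m] * N ^+ m (enum_rank k)
    * 'X_(enum_rank k) ^+ (d - m (enum_rank k))).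

Lemma poly_over_QP_swap_var N d p : poly_over_QP iota N ->
  poly_over_QP iota p -> poly_over_QP iota (swap_var N d p).
Proof.
move=> NQ pQ; apply: poly_over_QP_sum => // m; apply: poly_over_QPZ => //.
apply: poly_over_QPM => //; last first.
  by apply: poly_over_QP_exp => //; apply: poly_over_QPX.
apply: poly_over_QPM => //; last exact: poly_over_QP_exp.
exact: poly_over_QPX.
Qed.

(** In the term of a monomial with exponent [e <= d] in [X_k], the factor [N ^ e * X_k ^ (d - e)]
    takes at [u] the value [u_k ^ d * u'_k ^ e], because [N] takes the value [u_k * u'_k]. *)
Lemma eval_swap_var (N p : {mpoly F[#|J|]}) d (u u' : J -> F) :
  (forall m, m \in msupp p -> (m (enum_rank k) <= d)%N) ->
  (forall q, q != k -> u' q = u q) -> u k * u' k = eval_at u N ->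
  eval_at u (swap_var N d p) = u k ^+ d * eval_at u' p.
Proof.
move=> le_d uu' ukN.
rewrite /eval_at [in RHS](mpolyE p) !raddf_sum mulr_sumr /= big_seq [RHS]big_seq.
apply: eq_bigr => m /le_d md; rewrite !mevalZ mulrCA; congr (_ * _).
rewrite !mevalM !rmorphXn /= mevalXU enum_rankK !mevalX.
rewrite [X in X * _ * _ = _](bigD1 (enum_rank k)) //=.
rewrite [X in _ = _ * X](bigD1 (enum_rank k)) //=.
rewrite mnmE eqxx expr0 mul1r enum_rankK.
rewrite [in RHS](eq_bigr (fun i => u (enum_val i) ^+ forget_var m i)).
  rewrite /eval_at in ukN; rewrite -ukN exprMn -[in RHS](subnK md) exprD.
  by ring.
move=> i ik; rewrite mnmE (negPf ik) uu' //.
by apply: contraNneq ik => <-; rewrite enum_valK.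
Qed.

(** A relation [p] of [x'] gives the relation [swap_var N d p] of [x], which is thus the zero
    polynomial. The hypotheses are symmetric in [x] and [x'], so evaluating that same polynomial at
    [x'] gives [x'_k ^ d * p(x)]. Hence [p] is also a relation of [x]. *)
Lemma alg_indep_exchange (x x' : J -> F) (N : {mpoly F[#|J|]}) :
  poly_over_QP iota N -> alg_indep iota x ->
  (forall q, q != k -> x' q = x q) ->
  eval_at x' N = eval_at x N -> eval_at x N != 0 ->
  x k * x' k = eval_at x N -> alg_indep iota x'.
Proof.
move=> NQ x_indep xx' Nx' N0 xkN p pQ p0.
pose d := \max_(m <- msupp p) m (enum_rank k).
have le_d m : m \in msupp p -> (m (enum_rank k) <= d)%N.
  by move=> mp; apply: leq_bigmax_seq.
have x'k0 : x' k != 0 by apply: contraNneq N0 => x'k; rewrite -xkN x'k mulr0.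
have q0 : swap_var N d p = 0.
  apply: x_indep; first exact: poly_over_QP_swap_var.
  by rewrite (eval_swap_var le_d xx' xkN) p0 mulr0.
apply: x_indep => //; apply: (mulfI (expf_neq0 d x'k0)).
rewrite -(eval_swap_var le_d (u := x') (N := N)) ?mulr0.
- by rewrite q0 /eval_at meval0.
- by move=> q qk; rewrite xx'.
- by rewrite mulrC xkN Nx'.
Qed.
End Exchange.

(** * The exchange relation as a polynomial identity *)

Section MutationTheory.
Variables (P : groupType) (oplus : P -> P -> P).
Hypothesis P_semifield : semifield oplus.
Variables (F : fieldType) (iota : P -> F) (I : finType).
Hypothesis F_ambient : ambient_field iota I.

Let iota_1 := iota1 F_ambient.
Let iota_M := iotaM F_ambient.

Lemma iota_neq0 p : iota p != 0.
Proof.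
apply/eqP => p0; have := iota_M p p^-1.
by rewrite mulgV iota_1 p0 mul0r => /eqP; rewrite oner_eq0.
Qed.

Lemma iotaV p : iota p^-1%g = (iota p)^-1.
Proof.
apply: (mulfI (iota_neq0 p)).
by rewrite -iota_M mulgV iota_1 divff ?iota_neq0.
Qed.

(** Distinct group elements are linearly independent over the integers. The case [p = 1] is separate
    because the two terms then merge into one with coefficient 2. *)
Lemma iota_add1_neq0 p : iota p + 1 != 0.
Proof.
apply/eqP => p0; have [p1|p1] := eqVneq p 1%g.
  have := iota_free F_ambient (s := [:: 1%g]) (c := fun=> 2) isT.
  rewrite big_seq1 -p1 => /(_ _ p); rewrite mem_head => H.
  suff: (2 : int) = 0 by [].
  apply: H => //; move: p0; rewrite p1 iota_1 => p0.
  by rewrite mulr1; exact: p0.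
have := iota_free F_ambient (s := [:: p; 1%g]) (c := fun=> 1).
rewrite /= inE p1 big_cons big_seq1 !mul1r iota_1 => /(_ isT p0 p).
by rewrite mem_head => /(_ isT).
Qed.

Lemma alg_indep_inj (J : finType) (x : J -> F) :
  alg_indep iota x -> injective x.
Proof.
move=> x_indep i j xij; apply/eqP; apply: contraT => ij.
pose p : {mpoly F[#|J|]} := 'X_(enum_rank i) + (-1) *: 'X_(enum_rank j).
suff /mpolyP/(_ U_(enum_rank i)%MM) : p = 0.
  rewrite mcoeffD mcoeffZ !mcoeffXU mcoeff0 eqxx (inj_eq enum_rank_inj).
  by rewrite eq_sym (negPf ij) mulr0 addr0 => /eqP; rewrite oner_eq0.
apply: x_indep; last by rewrite /eval_at mevalD mevalZ !mevalXU !enum_rankK xij; ring.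
apply: poly_over_QPD => //; first exact: poly_over_QPX.
by apply: poly_over_QPZ => //; [exact: (in_QP_int iota_1 (-1))|exact: poly_over_QPX].
Qed.

Section Cluster.
Variables (J : finType) (S : seed P F J) (k : J).
Local Notation b := (seed_B S).
Local Notation y := (seed_Y S).
Local Notation x := (seed_X S).

(** The absolute value only casts the nonnegative integer [pos_part] to an exponent in [nat]. *)
Definition pos_monom (c : J -> int) : 'X_{1..#|J|} :=
  [multinom `|pos_part (c (enum_val i))|%N | i < #|J|].

Lemma eval_pos_monom (c : J -> int) (u : J -> F) :
  eval_at u 'X_[pos_monom c] = \prod_q u q ^ pos_part (c q).
Proof.
rewrite /eval_at mevalX [RHS](reindex (@enum_val J J)); last exact/onW_bij/enum_val_bij.
apply: eq_bigr => i _; rewrite mnmE exprnP gez0_abs //.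
by rewrite /pos_part le_max lexx orbT.
Qed.

Lemma pos_monom_eq0 (c : J -> int) : c k = 0 -> pos_monom c (enum_rank k) = 0%N.
Proof. by move=> ck; rewrite mnmE enum_rankK ck /pos_part maxxx. Qed.

(** The numerator of the exchange relation in direction [k], kept as a polynomial so that
    independence of the cluster applies to it. *)
Definition exchange_poly : {mpoly F[#|J|]} :=
  iota (y k) *: 'X_[pos_monom (b^~ k)] + 'X_[pos_monom (fun q => - b q k)].

Lemma poly_over_exchange_poly : poly_over_QP iota exchange_poly.
Proof.
apply: poly_over_QPD => //; last exact: poly_over_QPX.
by apply: poly_over_QPZ => //; [apply: in_QP_iota|apply: poly_over_QPX].
Qed.

Lemma eval_exchange_poly (u : J -> F) : eval_at u exchange_poly =
  iota (y k) * \prod_q u q ^ pos_part (b q k)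
  + \prod_q u q ^ pos_part (- b q k).
Proof.
by rewrite -!eval_pos_monom /eval_at mevalD mevalZ.
Qed.

Lemma mutate_XE : mutate_X oplus iota S k k =
  (iota (oplus (y k) 1%g) * x k)^-1 * eval_at x exchange_poly.
Proof. by rewrite /mutate_X eqxx eval_exchange_poly. Qed.

(** The coefficient of the second monomial is 1 if the two monomials differ, and [iota (y k) + 1] if
    they coincide. Neither vanishes. *)
Lemma exchange_poly_neq0 : exchange_poly != 0.
Proof.
apply/eqP => /mpolyP/(_ (pos_monom (fun q => - b q k))) /eqP.
rewrite mcoeffD mcoeffZ !mcoeffX mcoeff0 eqxx.
case: (pos_monom _ == _); first by rewrite mulr1 (negPf (iota_add1_neq0 _)).
by rewrite mulr0 add0r oner_eq0.
Qed.

Hypothesis x_indep : alg_indep iota x.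

Lemma eval_exchange_poly_neq0 : eval_at x exchange_poly != 0.
Proof.
apply: contraNneq exchange_poly_neq0 => N0; apply/eqP/x_indep => //.
exact: poly_over_exchange_poly.
Qed.

Lemma cluster_neq0 q : x q != 0.
Proof.
apply/eqP => q0.
suff /mpolyP/(_ U_(enum_rank q)%MM) : 'X_(enum_rank q) = 0 :> {mpoly F[#|J|]}.
  by rewrite mcoeffXU mcoeff0 eqxx => /eqP; rewrite oner_eq0.
by apply: x_indep; [exact: poly_over_QPX|rewrite /eval_at mevalXU enum_rankK].
Qed.

Hypothesis bkk : b k k = 0.

(** Since [b k k = 0], the variable [X_k] does not occur in the exchange polynomial. *)
Lemma exchange_poly_mutate (u : J -> F) : (forall q, q != k -> u q = x q) ->
  eval_at u exchange_poly = eval_at x exchange_poly.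
Proof.
move=> ux; rewrite !eval_exchange_poly.
by congr (_ * _ + _); apply: eq_bigr => q _; have [->|/ux->//] := eqVneq q k;
  rewrite bkk ?oppr0 /pos_part maxxx !expr0z.
Qed.

(** [x_k * x'_k] is the value of the exchange polynomial divided by [iota (y_k + 1)], the sum being
    that of the semifield, so the exchange argument applies with this multiple as [N]. *)
Lemma mutate_alg_indep : alg_indep iota (seed_X (mutate oplus iota S k)).
Proof.
pose c := iota (oplus (y k) 1%g)^-1%g.
have cN u : eval_at u (c *: exchange_poly) = c * eval_at u exchange_poly.
  by rewrite /eval_at mevalZ.
have xx' q : q != k -> mutate_X oplus iota S k q = x q.
  by rewrite /mutate_X => /negPf->.
apply: (alg_indep_exchange (k := k) (x := x) (N := c *: exchange_poly)
  iota_1 iota_M) => //.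
- by apply: poly_over_QPZ => //; [apply: in_QP_iota|apply: poly_over_exchange_poly].
- by rewrite !cN exchange_poly_mutate.
- by rewrite cN mulf_neq0 ?iota_neq0 ?eval_exchange_poly_neq0.
- rewrite cN [X in _ * X = _]mutate_XE /c iotaV; field.
  by rewrite iota_neq0 cluster_neq0.
Qed.

(** If [x'_k = x_k], the exchange relation becomes a polynomial relation of the cluster. Its
    coefficient at [X_k ^ 2] is a value of [iota], hence nonzero, since neither exchange monomial
    involves [X_k]. *)
Lemma mutate_X_neq : mutate_X oplus iota S k k != x k.
Proof.
apply/eqP => xk.
pose p : {mpoly F[#|J|]} := (-1) *: exchange_poly
  + iota (oplus (y k) 1%g) *: 'X_(enum_rank k) ^+ 2.
suff /mpolyP/(_ (U_(enum_rank k) *+ 2)%MM) : p = 0.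
  rewrite mcoeffD !mcoeffZ mcoeffXn !mcoeffD !mcoeffZ !mcoeffX mcoeff0 eqxx.
  have neq c : c k = 0 -> (pos_monom c == (U_(enum_rank k) *+ 2)%MM) = false.
    move=> ck; apply/eqP => /mnmP/(_ (enum_rank k)).
    by rewrite pos_monom_eq0 // mulmnE mnm1E eqxx.
  rewrite !neq ?bkk ?oppr0 // !mulr0 addr0 mulr0 add0r mulr1 => /eqP.
  by rewrite (negPf (iota_neq0 _)).
apply: x_indep.
  apply: poly_over_QPD => //; apply: poly_over_QPZ => //.
  - exact: (in_QP_int iota_1 (-1)).
  - exact: poly_over_exchange_poly.
  - exact: in_QP_iota.
  - by apply: poly_over_QP_exp => //; apply: poly_over_QPX.
have := mutate_XE; rewrite xk =>
  /(congr1 (fun z => (iota (oplus (y k) 1%g) * x k) * z)).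
rewrite mulVKf ?mulf_neq0 ?iota_neq0 ?cluster_neq0 // => xkN.
rewrite /eval_at mevalD !mevalZ rmorphXn /= mevalXU enum_rankK.
by rewrite /eval_at in xkN; rewrite -xkN; ring.
Qed.
End Cluster.
End MutationTheory.

(** * Relabeling, involutivity and the exchange graph *)

Section Transport.
Variables (P : groupType) (oplus : P -> P -> P).
Variables (F : fieldType) (iota : P -> F).

Lemma transported_id (J : finType) (S : seed P F J) : transported id S S.
Proof. by split=> //; exists id. Qed.

Lemma transported_comp (J K L : finType) (m : J -> K) (m' : K -> L)
    (S : seed P F J) (T : seed P F K) (U : seed P F L) :
  transported m S T -> transported m' T U -> transported (m' \o m) S U.
Proof.
move=> [m_bij mB mY mX] [m'_bij m'B m'Y m'X]; split.
- exact: bij_comp.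
- by move=> p q; rewrite /= m'B mB.
- by move=> p; rewrite /= m'Y mY.
- by move=> p; rewrite /= m'X mX.
Qed.

Lemma transported_inv (J K : finType) (m : J -> K) (m' : K -> J)
    (S : seed P F J) (T : seed P F K) :
  cancel m m' -> cancel m' m -> transported m S T -> transported m' T S.
Proof.
move=> mK m'K [m_bij mB mY mX]; split.
- by exists m.
- by move=> p q; rewrite -mB !m'K.
- by move=> p; rewrite -mY m'K.
- by move=> p; rewrite -mX m'K.
Qed.

Lemma transported_sym (J K : finType) (m : J -> K)
    (S : seed P F J) (T : seed P F K) :
  transported m S T -> exists m', transported m' T S.
Proof.
move=> mST; case: (mST) => -[m' mK m'K] _ _ _.
by exists m'; apply: transported_inv mST.
Qed.

Lemma transported_mutate (J K : finType) (m : J -> K)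
    (S : seed P F J) (T : seed P F K) (k : J) :
  transported m S T ->
  transported m (mutate oplus iota S k) (mutate oplus iota T (m k)).
Proof.
move=> [m_bij mB mY mX]; have m_inj := bij_inj m_bij; split=> //=.
- by move=> p q; rewrite /mutate_B !(inj_eq m_inj) !mB.
- by move=> p; rewrite /mutate_Y (inj_eq m_inj) !mB !mY.
- move=> p; rewrite /mutate_X (inj_eq m_inj) mX mY mX.
  case: ifP => // _; rewrite !(reindex m) /=; try exact: onW_bij.
  by congr (_ * (_ * _ + _)); apply: eq_bigr => q _; rewrite mB mX.
Qed.

Section Unlabeled.
Variable I : finType.

Lemma unlabeled_transported (J K : finType) (m : J -> K)
    (S : seed P F J) (T : seed P F K) :
  transported m S T -> unlabeled I S = unlabeled I T.
Proof.
move=> mST; have [m' m'TS] := transported_sym mST.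
apply/seteqP; split=> U [m0 m0U].
- by exists (m0 \o m'); apply: transported_comp m0U.
- by exists (m0 \o m); apply: transported_comp m0U.
Qed.

Lemma unlabeled_inj (S T : seed P F I) :
  unlabeled I S = unlabeled I T -> exists m, transported m S T.
Proof.
move=> ST; suff: unlabeled I S T by [].
by rewrite ST; exists id; apply: transported_id.
Qed.
End Unlabeled.
End Transport.

(** * Mutation is an involution, and distinct directions give distinct neighbours *)

Section Involution.
Variables (P : groupType) (oplus : P -> P -> P).
Hypothesis P_semifield : semifield oplus.
Variables (F : fieldType) (iota : P -> F) (I : finType).
Hypothesis F_ambient : ambient_field iota I.

Lemma pos_part_nat (n : nat) : pos_part n%:Z = n%:Z.
Proof. by rewrite /pos_part; apply/max_idPl. Qed.

Lemma pos_part_oppnat (n : nat) : pos_part (- n%:Z) = 0.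
Proof. by rewrite /pos_part; apply/max_idPr; rewrite oppr_le0. Qed.

Lemma gexpzN (x : P) (m : int) : gexpz x (- m) = (gexpz x m)^-1%g.
Proof. by case: m => [[|n]|n] //=; rewrite ?expg0 ?invg1 ?invgK. Qed.

Section OneSeed.
Variables (J : finType) (S : seed P F J) (k : J).
Let S' := mutate oplus iota S k.

(** Row and column [k] change sign, so the product of their entries is unchanged while the sign in
    front of the correction is reversed. The two corrections cancel. *)
Lemma mutateB_involutive p q : mutate_B S' k p q = seed_B S p q.
Proof.
rewrite /mutate_B /= /mutate_B eqxx orbT /=.
case: (_ || _); first by rewrite opprK.
by rewrite sgrN mulrNN mulNr addrK.
Qed.

Lemma oplus_inv1 (y : P) : oplus y^-1%g 1%g = (y^-1 * oplus y 1)%g.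
Proof.
rewrite (sf_mulC P_semifield) (sf_mulDl P_semifield) mulgV mul1g.
exact: sf_addC P_semifield _ _.
Qed.

Lemma mutateY_involutive p : mutate_Y oplus S' k p = seed_Y S p.
Proof.
rewrite /mutate_Y /= /mutate_Y eqxx /mutate_B eqxx /=.
case: ifP => [/eqP->|pk]; first by rewrite invgK.
rewrite pk oplus_inv1; set y := seed_Y S k; set z := oplus y 1%g.
have zn n : ((y^-1 * z) ^+ n)%g = (y ^- n * z ^+ n)%g.
  by rewrite expgMn ?expVgn //; apply: (sf_mulC P_semifield).
have mC := sf_mulC P_semifield.
(* According to the sign of [b k p], the power of [y_k] appears in exactly one of the two mutations,
   and [oplus_inv1] compensates for it. *)
case: (intP (seed_B S k p)) => [|n|n].
- by rewrite !oppr0 /pos_part maxxx /= !expg0 !mulg1.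
- rewrite opprK pos_part_nat pos_part_oppnat [gexpz _ 0]expg0 mulg1 gexpzN.
  rewrite [gexpz (_ * _) _]zn /=.
  by rewrite (mC (y ^- _)%g) !mulgA mulgVK mulgK.
- rewrite !opprK pos_part_nat pos_part_oppnat [gexpz _ 0]expg0 mulg1 gexpzN.
  rewrite [gexpz (_ * _) _]zn /= expVgn (mC (y ^- _)%g (z ^+ _)%g).
  by rewrite invgM invgK !mulgA mulgVK mulgK.
Qed.

Hypothesis bkk : seed_B S k k = 0.
Hypothesis x'k0 : seed_X S' k != 0.

Lemma mutateX_involutive p : mutate_X oplus iota S' k p = seed_X S p.
Proof.
rewrite /mutate_X; case: ifP => [/eqP->{p}|pk]; last by rewrite /= /mutate_X pk.
(* Column [k] has changed sign, so the two exchange monomials trade places. The new variable has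
   exponent zero in both because [b k k = 0]. *)
set M2 := (X in _ * (iota _ * X + _)); set M1 := (X in _ * (_ * _ + X)).
have -> : M2 = \prod_q seed_X S q ^ pos_part (- seed_B S q k).
  apply: eq_bigr => q _; rewrite /= /mutate_B /mutate_X eqxx orbT.
  by case: eqP => // ->; rewrite bkk oppr0 /pos_part maxxx !expr0z.
have -> : M1 = \prod_q seed_X S q ^ pos_part (seed_B S q k).
  apply: eq_bigr => q _; rewrite /= /mutate_B /mutate_X eqxx orbT opprK.
  by case: eqP => // ->; rewrite bkk /pos_part maxxx !expr0z.
have := x'k0; rewrite /= /mutate_X /mutate_Y !eqxx.
rewrite oplus_inv1 (iotaM F_ambient) (iotaV F_ambient).
rewrite mulf_eq0 invr_eq0 mulf_eq0 (negPf (iota_neq0 F_ambient _)) /= negb_or.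
move=> /andP[xk0 N0]; field.
by rewrite N0 xk0 !(iota_neq0 F_ambient).
Qed.

Lemma mutate_involutive : mutate oplus iota S' k = S.
Proof.
rewrite /mutate [RHS](_ : S = Seed (seed_B S) (seed_Y S) (seed_X S)); last by case: S.
congr Seed.
- by apply/funext => p; apply/funext => q; apply: mutateB_involutive.
- by apply/funext => p; apply: mutateY_involutive.
- by apply/funext => p; apply: mutateX_involutive.
Qed.
End OneSeed.

Section Exchanges.
Variables (S : seed P F I).
Hypothesis S_diag : forall k, seed_B S k k = 0.
Hypothesis S_indep : alg_indep iota (seed_X S).

(** A relabeling would make [x_k] a member of the mutated cluster. It is neither the new variable
    nor, by injectivity of the cluster, one of the others. *)
Lemma unlabeled_mutate_neq k :
  unlabeled I (mutate oplus iota S k) <> unlabeled I S.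
Proof.
case/unlabeled_inj => m [[m' mK m'K] _ _ mX].
have := mX (m' k); rewrite m'K /= => xk.
have := mutate_X_neq oplus F_ambient S_indep (S_diag k).
have [m'k|m'k] := eqVneq (m' k) k; first by rewrite xk m'k eqxx.
case/eqP: (m'k); apply: (alg_indep_inj F_ambient S_indep).
by rewrite xk /mutate_X (negPf m'k).
Qed.

(** If [k] and [l] differ, mutation at [k] keeps [x_l], which would then occur in the cluster
    mutated at [l], from which it was removed. *)
Lemma unlabeled_mutate_inj k l :
  unlabeled I (mutate oplus iota S k) = unlabeled I (mutate oplus iota S l) ->
  k = l.
Proof.
case/unlabeled_inj => m [_ _ _ mX]; apply/eqP; apply: contraT => kl.
have := mX l; rewrite /= {2}/mutate_X eq_sym (negPf kl) => xl.
have := mutate_X_neq oplus F_ambient S_indep (S_diag l).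
have [ml|ml] := eqVneq (m l) l; first by rewrite -xl ml eqxx.
case/eqP: (ml); apply: (alg_indep_inj F_ambient S_indep).
by rewrite -xl /mutate_X (negPf ml).
Qed.

(** An edge records a mutation starting at one of its ends. When [c] is the other end, involutivity
    turns it into a mutation starting at [c]. In both cases the direction is carried over to [S] by
    a relabeling. *)
Lemma exchange_edge_mutate (S0 : seed P F I)
    (c : vert (exchange_graph oplus iota S0))
    (E : edge (exchange_graph oplus iota S0)) :
  val c = unlabeled I S -> c \in ends E ->
  exists k c', val c' = unlabeled I (mutate oplus iota S k) /\
               ends E = [fset c; c']%fset.
Proof.
case: E => A /= AE cS cA; case/asboolP: (AE) => S1 [k [d [d' [_ dS1 d'S1 dd']]]].
move: cA; rewrite dd' !inE => /orP[]/eqP cd; subst c.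
  have [m mT] := unlabeled_inj (etrans (esym dS1) cS).
  exists (m k), d'; split=> //; rewrite d'S1.
  exact: unlabeled_transported (transported_mutate _ _ _ mT).
have [m mT] := unlabeled_inj (etrans (esym d'S1) cS).
exists (m k), d; split; last exact: fsetUC.
rewrite dS1 -(unlabeled_transported I (transported_mutate oplus iota k mT)).
rewrite mutate_involutive //; case: mT => _ mB _ mX.
- have := mB k k; rewrite S_diag /= /mutate_B eqxx /= => /esym/eqP.
  by rewrite oppr_eq0 => /eqP.
- by rewrite -mX; apply: (cluster_neq0 F_ambient S_indep).
Qed.
End Exchanges.
End Involution.

(** * Labels of a framework *)

Section PosPart.
Variable K : realDomainType.
Implicit Types x y : K.

Lemma pos_partN x : pos_part (- x) = pos_part x - x.
Proof.
rewrite /pos_part; case: (leP x 0) => [x0|/ltW x0].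
  by rewrite sub0r; apply/max_idPl; rewrite oppr_ge0.
by rewrite subrr; apply/max_idPr; rewrite oppr_le0.
Qed.

Lemma pos_part_ge0 x : 0 <= x -> pos_part x = x.
Proof. by move=> x0; apply/max_idPl. Qed.

Lemma pos_partM x y : 0 <= x -> pos_part (x * y) = x * pos_part y.
Proof. by move=> x0; rewrite /pos_part maxr_pMr // mulr0. Qed.

Lemma sg_pos_part_prod x y :
  Num.sg x * pos_part (x * y) = if 0 <= x then x * pos_part y
                                else x * pos_part (- y).
Proof.
case: (ltgtP x 0) => [x0|x0|->]; last by rewrite sgr0 !mul0r.
  by rewrite ltr0_sg // -[x * y]mulrNN pos_partM ?oppr_ge0 ?ltW // mulN1r mulNr opprK.
by rewrite gtr0_sg // mul1r pos_partM // ltW.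
Qed.

(** With [x = b_ik] and [y = b_kj], the left side is the correction produced by the transition rules
    at a label of sign [eps], and the right side is that of matrix mutation. The identity
    [pos_part (- x) = pos_part x - x] makes the choice of sign immaterial. *)
Lemma signed_exchange x y eps : eps = 1 \/ eps = -1 ->
  pos_part (eps * y) * x + pos_part (- eps * x) * y
  = Num.sg x * pos_part (x * y).
Proof.
rewrite sg_pos_part_prod; case: (leP 0 x) => [x0|/ltW x0] [] ->.
- by rewrite mul1r mulN1r pos_partN (pos_part_ge0 x0); ring.
- by rewrite opprK mul1r mulN1r pos_partN (pos_part_ge0 x0); ring.
- rewrite mul1r mulN1r (pos_part_ge0 (x := - x)) ?oppr_ge0 // pos_partN; ring.
- rewrite opprK mul1r mulN1r pos_partN.
  have -> : pos_part x = 0 by apply/max_idPr.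
  by ring.
Qed.
End PosPart.

Lemma pos_part_intr (K : realDomainType) (z : int) :
  (pos_part z)%:~R = pos_part (z%:~R : K).
Proof.
rewrite /pos_part; case: (leP z 0) => [z0|/ltW z0].
  by apply/esym/max_idPr; rewrite lerz0.
by apply/esym/max_idPl; rewrite ler0z.
Qed.

(** * Free families and bilinear forms *)

Section LinearFamilies.
Variables (R : realType) (I : finType) (V : vectType R).

Definition lin_free (v : I -> V) : Prop :=
  forall c : I -> R, \sum_i c i *: v i = 0 -> forall i, c i = 0.

Lemma sum_scale_delta (v : I -> V) (a : R) (k : I) :
  \sum_i (a *+ (i == k)) *: v i = a *: v k.
Proof.
rewrite (bigD1 k) //= eqxx big1 ?addr0 // => i /negPf->.
by rewrite mulr0n scale0r.
Qed.

Lemma lin_free_inj v : lin_free v -> injective v.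
Proof.
move=> v_free i j vij; apply/eqP; apply: contraT => ij.
have := v_free (fun l => 1 *+ (l == i) - 1 *+ (l == j)).
under eq_bigr do rewrite scalerBl.
rewrite sumrB !sum_scale_delta vij subrr => /(_ erefl i).
by rewrite eqxx (negPf ij) subr0 => /eqP; rewrite oner_eq0.
Qed.

Lemma basis_lin_free (v : I -> V) :
  basis_of fullv [seq v i | i <- enum I] -> lin_free v.
Proof.
move=> /basis_free v_free c c0 i.
have /freeP : free (codom_tuple v) by [].
move=> /(_ (fun j => c (enum_val j))).
suff -> : \sum_(j < #|I|) c (enum_val j) *: (codom_tuple v)`_j = 0.
  by move=> /(_ erefl (enum_rank i)); rewrite enum_rankK.
rewrite -[RHS]c0 [RHS](reindex (@enum_val I I)); last exact/onW_bij/enum_val_bij.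
by apply: eq_bigr => j _; rewrite nth_codom.
Qed.

Lemma basis_span (v : I -> V) x : basis_of fullv [seq v i | i <- enum I] ->
  exists c : I -> R, x = \sum_i c i *: v i.
Proof.
move=> v_basis; have v_basis' : basis_of fullv (codom_tuple v) by [].
exists (fun i => coord (codom_tuple v) (enum_rank i) x).
rewrite {1}(coord_basis v_basis' (memvf x)).
rewrite [RHS](reindex (@enum_val I I)); last exact/onW_bij/enum_val_bij.
by apply: eq_bigr => j _; rewrite enum_valK nth_codom.
Qed.
End LinearFamilies.

Section Forms.
Variables (R : realType) (V : vectType R) (omega : V -> V -> R).
Hypothesis omega_bilinear : bilinear_form omega.

Lemma omegaPr x a u v : omega x (a *: u + v) = a * omega x u + omega x v.
Proof. exact: omega_bilinear.1. Qed.

Lemma omegaPl x a u v : omega (a *: u + v) x = a * omega u x + omega v x.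
Proof. exact: omega_bilinear.2. Qed.

Lemma omega0r x : omega x 0 = 0.
Proof.
have := omegaPr x 1 0 0; rewrite scaler0 addr0 mul1r => /eqP.
by rewrite -subr_eq0 opprD addNKr oppr_eq0 => /eqP.
Qed.

Lemma omega0l x : omega 0 x = 0.
Proof.
have := omegaPl x 1 0 0; rewrite scaler0 addr0 mul1r => /eqP.
by rewrite -subr_eq0 opprD addNKr oppr_eq0 => /eqP.
Qed.

Lemma omegaZr x a u : omega x (a *: u) = a * omega x u.
Proof. by rewrite -[a *: u]addr0 omegaPr omega0r addr0. Qed.

Lemma omegaZl x a u : omega (a *: u) x = a * omega u x.
Proof. by rewrite -[a *: u]addr0 omegaPl omega0l addr0. Qed.

Lemma omegaDr x u v : omega x (u + v) = omega x u + omega x v.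
Proof. by rewrite -[u]scale1r omegaPr mul1r scale1r. Qed.

Lemma omegaDl x u v : omega (u + v) x = omega u x + omega v x.
Proof. by rewrite -[u]scale1r omegaPl mul1r scale1r. Qed.

Lemma omegaNr x u : omega x (- u) = - omega x u.
Proof. by rewrite -scaleN1r omegaZr mulN1r. Qed.

Lemma omegaNl x u : omega (- u) x = - omega u x.
Proof. by rewrite -scaleN1r omegaZl mulN1r. Qed.

Lemma omega_suml (I : finType) x (f : I -> V) :
  omega (\sum_i f i) x = \sum_i omega (f i) x.
Proof. exact: (big_morph (omega^~ x) (fun u v => omegaDl x u v) (omega0l x)). Qed.

Lemma omega_sumr (I : finType) x (f : I -> V) :
  omega x (\sum_i f i) = \sum_i omega x (f i).
Proof. exact: (big_morph (omega x) (omegaDr x) (omega0r x)). Qed.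
End Forms.

Lemma joinedC (G : quasi_graph) (e : edge G) u v : joined e u v = joined e v u.
Proof. by rewrite /joined eq_sym fsetUC. Qed.

Lemma joined_ends (G : quasi_graph) (e : edge G) u v :
  joined e u v -> u \in ends e /\ v \in ends e.
Proof. by case/andP=> _ /eqP->; rewrite !inE !eqxx orbT. Qed.

Lemma joined_inj (G : quasi_graph) (e f : edge G) u v :
  joined e u v -> joined f u v -> e = f.
Proof.
case/andP=> uv /eqP eE /andP[_ /eqP fE]; apply: full_simple; rewrite eE ?fE //.
by rewrite cardfs2 uv.
Qed.

(** * Exchange matrices read off from labels and co-labels *)

Section FrameworkTheory.
Variables (R : realType) (I : finType) (B : I -> I -> int) (delta : I -> R).
Hypothesis B_skew : skew_symmetrized_by delta B.
Variables (V : vectType R) (alpha : I -> V).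
Hypothesis alpha_basis : basis_of fullv [seq alpha i | i <- enum I].
Variable omega : V -> V -> R.
Hypothesis omega_bilinear : bilinear_form omega.
Hypothesis omegaE :
  forall i j, omega (coroot delta alpha i) (alpha j) = (B i j)%:~R.

Let alpha_free : lin_free alpha := basis_lin_free alpha_basis.

(** On simple roots [omega] takes the values [delta i * B i j], so there the claim is the
    skew-symmetrizability of [B]. Bilinearity extends it to [V]. *)
Lemma omega_skew x y : omega x y = - omega y x.
Proof.
have aE i j : omega (alpha i) (alpha j) = delta i * (B i j)%:~R.
  rewrite -omegaE /coroot omegaZl // mulrA divff ?mul1r //.
  by rewrite gt_eqF //; case: B_skew.
have [c ->] := basis_span x alpha_basis.
have [d ->] := basis_span y alpha_basis.
rewrite !omega_suml //.
under eq_bigr do rewrite omega_sumr //.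
under [in RHS]eq_bigr do rewrite omega_sumr //.
rewrite exchange_big /= -sumrN; apply: eq_bigr => j _.
rewrite -sumrN; apply: eq_bigr => i _.
rewrite !omegaZl // !omegaZr // !aE (proj2 B_skew i j); ring.
Qed.

Lemma omegaxx x : omega x x = 0.
Proof.
have /eqP := omega_skew x x; rewrite -addr_eq0 -mulr2n mulrn_eq0 /=.
by move/eqP.
Qed.

Local Notation sgn := (sgn alpha).
Local Notation nonneg_span := (nonneg_span alpha).

Lemma sgn_cases x : sgn x = 1 \/ sgn x = -1.
Proof. by rewrite /sgn; case: asboolP; [left|right]. Qed.

Lemma nonneg_spanZ t x : 0 <= t -> nonneg_span x -> nonneg_span (t *: x).
Proof.
move=> t0 [c c0 ->]; exists (fun i => t * c i) => [i|].
  by rewrite mulr_ge0.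
by rewrite scaler_sumr; apply: eq_bigr => i _; rewrite scalerA.
Qed.

Lemma sgnZ t x : 0 < t -> sgn (t *: x) = sgn x.
Proof.
move=> t0; rewrite /sgn; congr (if _ then _ else _); apply: asbool_equiv_eq.
split; last exact/nonneg_spanZ/ltW.
move=> /(nonneg_spanZ (ltW (etrans (invr_gt0 _) t0))).
by rewrite scalerA mulVf ?scale1r // gt_eqF.
Qed.

(** A nonzero vector and its opposite are not both in the nonnegative span: their coefficients would
    be nonnegative with sum zero, hence all zero. *)
Lemma sgnN x : x <> 0 -> nonneg_span x \/ nonneg_span (- x) ->
  sgn (- x) = - sgn x.
Proof.
move=> x0 xs; rewrite /sgn; case: asboolP => [Nx|Nx]; case: asboolP => [px|px].
- case: x0; case: px Nx => c c0 -> [d d0] /eqP.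
  rewrite eq_sym -addr_eq0 -big_split /= => /eqP cd.
  have cd0 i : c i + d i = 0.
    move: i; apply: alpha_free; rewrite -[RHS]cd; apply: eq_bigr => i _.
    by rewrite scalerDl addrC.
  apply: big1 => i _; have := cd0 i => /eqP.
  by rewrite paddr_eq0 // => /andP[/eqP-> _]; rewrite scale0r.
- by rewrite opprK.
- by [].
- by case: xs.
Qed.

Variables (G : quasi_graph) (C Cv : vert G -> edge G -> V) (vb : vert G).
Hypothesis G_framework : framework delta alpha omega C Cv vb.

Local Notation mu_rel := (mu_rel alpha omega C Cv).

(* [lab] identifies [I] with [I(u)], [b] is the exchange matrix at [u] read
   through this identification. *)
Record labeling (u : vert G) (lab : I -> edge G) (b : I -> I -> int) : Prop :=
  Labeling {
  lab_in : forall i, u \in ends (lab i);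
  lab_surj : forall e, u \in ends e -> exists i, lab i = e;
  lab_free : lin_free (fun i => C u (lab i));
  labB : forall i j, (b i j)%:~R = omega (Cv u (lab i)) (C u (lab j)) }.

Lemma lab_inj u lab b : labeling u lab b -> injective lab.
Proof.
move=> L i j ij; apply: (lin_free_inj (lab_free L)); by rewrite ij.
Qed.

Lemma labeling_diag u lab b k : labeling u lab b -> b k k = 0.
Proof.
move=> L; have := labB L k k.
have [t _ ->] := fw_colabel G_framework (lab_in L k).
by rewrite omegaZl // omegaxx mulr0 => /eqP; rewrite intr_eq0 => /eqP.
Qed.

(** If each co-label is [t i] times its label, the inverses of the [t i] symmetrize: they turn
    [b i j] into [omega] of two labels, which is skew. *)
Lemma labeling_skew u lab b : labeling u lab b -> skew_symmetrizable R b.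
Proof.
move=> L.
have /choice[t tP] : forall i, exists t : R,
    0 < t /\ Cv u (lab i) = t *: C u (lab i).
  by move=> i; have [t t0 tE] := fw_colabel G_framework (lab_in L i); exists t.
exists (fun i => (t i)^-1); split=> [i|i j]; first by rewrite invr_gt0; case: (tP i).
have [ti0 tiE] := tP i; have [tj0 tjE] := tP j.
rewrite !(labB L) tiE tjE !omegaZl // !mulKf ?gt_eqF //.
exact: omega_skew.
Qed.

(* As many labels as edges at [u], so injectivity gives surjectivity. *)
Lemma labels_surj u (lab : I -> edge G) : injective lab ->
  (forall i, u \in ends (lab i)) ->
  forall e, u \in ends e -> exists i, lab i = e.
Proof.
move=> lab_inj lab_u e ue.
have Iu := fw_regular G_framework u.
have fin_u : finite_set (incident_edges u) by exists #|I|.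
have cardu : #|` star u|%fset = #|I|.
  by apply/card_eq_fsetP; rewrite fset_setK.
have e_star : e \in star u by rewrite in_fset_set // mem_set.
pose A := [fset lab i | i in I]%fset.
have AE : A = star u.
  apply/eqP; rewrite eqEfcard; apply/andP; split.
    by apply/fsubsetP => _ /imfsetP[i _ ->];
      rewrite in_fset_set ?mem_set //; apply: lab_u.
  by rewrite cardu card_imfset //= cardE.
by move: e_star; rewrite -AE => /imfsetP[i _ ->]; exists i.
Qed.

Section Step.
Variables (u u' : vert G) (lab lab' : I -> edge G) (b : I -> I -> int) (k : I).
Hypothesis L : labeling u lab b.
Hypothesis kuu' : joined (lab k) u u'.

Lemma mu_rel_exists i : exists f, mu_rel (lab k) u u' (lab i) f.
Proof.
rewrite /mu_rel (inj_eq (lab_inj L)); have [_|ik] := eqVneq i k.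
  by exists (lab k).
have Cik : C u (lab i) <> C u (lab k).
  by move/(lin_free_inj (lab_free L))/eqP; apply/negP.
by have [f uf <-] := fw_transition G_framework kuu' (lab_in L i) Cik; exists f.
Qed.

Hypothesis lab'P : forall i, mu_rel (lab k) u u' (lab i) (lab' i).
Let cf i := pos_part (sgn (C u (lab k)) * omega (Cv u (lab k)) (C u (lab i))).

Lemma lab'k : lab' k = lab k.
Proof. by have := lab'P k; rewrite /mu_rel eqxx. Qed.

Lemma lab'_in i : u' \in ends (lab' i).
Proof.
have := lab'P i; rewrite /mu_rel; case: ifP => [_ ->|_ [] //].
by have [] := joined_ends kuu'.
Qed.

Lemma C_lab'k : C u' (lab' k) = - C u (lab k).
Proof. by rewrite lab'k; case: (fw_opp G_framework kuu'). Qed.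

Lemma Cv_lab'k : Cv u' (lab' k) = - Cv u (lab k).
Proof. by rewrite lab'k; case: (fw_opp G_framework kuu'). Qed.

Lemma C_lab' i : i != k -> C u' (lab' i) = C u (lab i) + cf i *: C u (lab k).
Proof.
by move=> ik; have := lab'P i; rewrite /mu_rel (inj_eq (lab_inj L)) (negPf ik) => -[].
Qed.

(** The labels at [u'] arise from those at [u] by negating the [k]-th one and adding multiples of it
    to the others, an invertible change. *)
Lemma lab'_free : lin_free (fun i => C u' (lab' i)).
Proof.
move=> d; rewrite (bigD1 k) //= C_lab'k.
rewrite (eq_bigr (fun i => d i *: C u (lab i) + (d i * cf i) *: C u (lab k)));
  last by move=> i ik; rewrite C_lab' // scalerDr scalerA.
rewrite big_split -scaler_suml /= => d0.
have dk i : i != k -> d i = 0.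
  (* The coefficients of the same relation, rewritten on the labels at [u]. *)
  move=> ik; pose d' i := if i == k then \sum_(j | j != k) d j * cf j - d k else d i.
  have := lab_free L (c := d') _ i; rewrite /d' (negPf ik); apply.
  rewrite (bigD1 k) //= eqxx -[RHS]d0 scalerBl scalerN.
  rewrite (eq_bigr (fun i => d i *: C u (lab i))); last by move=> j /negPf->.
  by rewrite addrAC addrC [X in _ + X = _]addrC.
move=> i; have [->|/dk//] := eqVneq i k; move: d0.
rewrite !big1 ?scale0r ?addr0; try by move=> j /dk->; rewrite ?scale0r ?mul0r.
move/eqP; rewrite scaler_eq0 oppr_eq0 => /orP[/eqP//|/eqP].
by move/(fw_nonzero G_framework (lab_in L k)).
Qed.

Lemma lab'_surj e : u' \in ends e -> exists i, lab' i = e.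
Proof.
apply: labels_surj lab'_in _ => i j ij.
by apply: (lin_free_inj lab'_free); rewrite ij.
Qed.

Lemma sgn_colabel : sgn (Cv u (lab k)) = sgn (C u (lab k)).
Proof.
by have [t t0 ->] := fw_colabel G_framework (lab_in L k); rewrite sgnZ.
Qed.

(* The co-label produced by the transition condition is a positive multiple of
   some label at [u'], whose index is read off in the basis of labels at [u']. *)
Lemma Cv_lab' i : i != k -> Cv u' (lab' i) = Cv u (lab i)
  + pos_part (- sgn (C u (lab k)) * omega (Cv u (lab i)) (C u (lab k)))
    *: Cv u (lab k).
Proof.
move=> ik; have Cik : C u (lab i) <> C u (lab k).
  by move/(lin_free_inj (lab_free L))/eqP; apply/negP.
have [f uf] := fw_cotransition G_framework kuu' (lab_in L i) Cik.
rewrite sgn_colabel; set a := pos_part _.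
have [j <- {uf f}] := lab'_surj uf.
have [s s0 CvE] := fw_colabel G_framework (lab_in L i).
have [r _ CvkE] := fw_colabel G_framework (lab_in L k).
have [t _ Cv'E] := fw_colabel G_framework (lab'_in j).
have [-> //|ij] := eqVneq j i => E; exfalso.
have CkE : C u (lab k) = - C u' (lab' k) by rewrite C_lab'k opprK.
have CiE : C u (lab i) = C u' (lab' i) + cf i *: C u' (lab' k).
  by rewrite C_lab' // C_lab'k scalerN addrK.
(* If [j] differed from [i], writing both sides of [E] in the labels at [u'] would give a relation
   with coefficients [s], [z] and [- t] at [i], [k] and [j]. Its coefficient at [i] is [s > 0], even
   if [j = k]. *)
pose z := s * cf i - a * r.
have := lab'_free (c := fun l => s *+ (l == i) + z *+ (l == k) - t *+ (l == j)) _ i.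
rewrite eqxx (negPf ik) eq_sym (negPf ij) addr0 subr0 => H.
suff: s = 0 by move=> s00; rewrite s00 ltxx in s0.
apply: H; under eq_bigr do rewrite scalerBl scalerDl.
rewrite sumrB big_split /= !sum_scale_delta -Cv'E E CvE CvkE CkE CiE.
rewrite scalerDr !scalerA scalerN scalerBl.
apply/eqP; rewrite subr_eq0 addrA; apply/eqP; congr (_ + _).
Qed.

(** As [omega] vanishes on the [k]-th co-label and label, row and column [k] just change sign.
    Elsewhere the expansion leaves the old entry plus the two corrections that [signed_exchange]
    combines. *)
Lemma labeling_step (P : groupType) (F : fieldType) (T : seed P F I) :
  seed_B T = b -> labeling u' lab' (mutate_B T k).
Proof.
move=> bE; split; [exact: lab'_in|exact: lab'_surj|exact: lab'_free|].
have kk : omega (Cv u (lab k)) (C u (lab k)) = 0.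
  have [t _ ->] := fw_colabel G_framework (lab_in L k).
  by rewrite omegaZl // omegaxx mulr0.
move=> i j; rewrite /mutate_B bE.
have [->|ik] := eqVneq i k => /=.
  rewrite intrN (labB L) Cv_lab'k omegaNl //; congr (- _).
  have [->|jk] := eqVneq j k; first by rewrite C_lab'k omegaNr // kk oppr0.
  by rewrite C_lab' // omegaDr // omegaZr // kk mulr0 addr0.
have [->|jk] := eqVneq j k => /=.
  rewrite intrN (labB L) C_lab'k omegaNr //; congr (- _).
  by rewrite Cv_lab' // omegaDl // omegaZl // kk mulr0 addr0.
rewrite intrD intrM pos_part_intr intr_sg intrM !(labB L).
rewrite C_lab' // Cv_lab' // omegaDr // omegaDl // omegaZr // omegaDl //.
rewrite !omegaZl // kk mulr0 addr0 -addrA; congr (_ + _).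
rewrite -(signed_exchange _ _ (sgn_cases (C u (lab k)))) addrC; congr (_ + _).
Qed.

(** Crossing back, the [k]-th label, its co-label and its sign are all negated. The coefficient of
    the correction stays the same, since [omega x x = 0], but it now multiplies the opposite vector
    and undoes the first step. *)
Lemma mu_rel_rev i : mu_rel (lab k) u' u (lab' i) (lab i).
Proof.
have lab'_inj : injective lab'.
  by move=> p q pq; apply: (lin_free_inj lab'_free); rewrite pq.
rewrite /mu_rel -{1}lab'k (inj_eq lab'_inj).
have [-> //|ik] := eqVneq i k; split; first exact: lab_in L i.
have [Ck Cvk] := fw_opp G_framework kuu'.
have [t _ CvE] := fw_colabel G_framework (lab_in L k).
rewrite Ck Cvk sgnN; last 2 first.
- exact: fw_nonzero G_framework _ _ (lab_in L k).
- exact: fw_sign G_framework _ _ (lab_in L k).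
rewrite omegaNl // mulrNN C_lab' // omegaDr // omegaZr // {2}CvE omegaZl //.
by rewrite omegaxx !mulr0 addr0 scalerN addrK.
Qed.
End Step.

Lemma base_labels_exist :
  exists lab : I -> edge G, forall i, vb \in ends (lab i) /\ C vb (lab i) = alpha i.
Proof.
suff /choice[lab labP] : forall i, exists e,
    vb \in ends e /\ C vb e = alpha i by exists lab.
move=> i; have : labels C vb (alpha i).
  by rewrite (fw_base G_framework); exists i.
by move=> [e ve eE]; exists e.
Qed.

Lemma base_labeling lab :
  (forall i, vb \in ends (lab i) /\ C vb (lab i) = alpha i) -> labeling vb lab B.
Proof.
move=> labP; have lab_vb i : vb \in ends (lab i) by case: (labP i).
have labC i : C vb (lab i) = alpha i by case: (labP i).
have alpha_inj := lin_free_inj alpha_free.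
have lab_inj : injective lab.
  by move=> i j ij; apply: alpha_inj; rewrite -!labC ij.
have surj := labels_surj lab_inj lab_vb.
(* The framework only gives the co-labels at [vb] as a set. The co-root of index [i] sits on some
   edge [lab j], where it is a multiple of [alpha j], and freeness of the simple roots forces
   [i = j]. *)
have labCv i : Cv vb (lab i) = coroot delta alpha i.
  have : labels Cv vb (coroot delta alpha i).
    by rewrite (fw_cobase G_framework); exists i.
  move=> [e ve eE]; have [j je] := surj e ve; have [t _ tE] := fw_colabel G_framework ve.
  suff ij : i = j by rewrite ij je eE ij.
  apply/eqP; apply: contraT => ij.
  have := alpha_free (c := fun l => (delta i)^-1 *+ (l == i) - t *+ (l == j)) _ i.
  under eq_bigr do rewrite scalerBl.
  rewrite sumrB !sum_scale_delta -[_ *: alpha i]/(coroot delta alpha i) -eE tE.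
  rewrite -je labC subrr eqxx (negPf ij) subr0 => /(_ erefl)/eqP.
  by rewrite invr_eq0 gt_eqF //; case: B_skew.
split=> //; first by move=> c; under eq_bigr do rewrite labC; apply: alpha_free.
by move=> i j; rewrite labCv labC omegaE.
Qed.
End FrameworkTheory.

(** * The universal cover *)

Section CoverTheory.
Variables (G : quasi_graph) (vb : vert G).
Local Notation cvert := (cover_vert vb).
Local Notation proj := (@cover_proj G vb).

Lemma cover_val_seq (w : cvert) : cover_seq vb (val w).
Proof. exact/asboolP/(valP w). Qed.

Lemma cover_val_size (w : cvert) : (0 < size (val w))%N.
Proof. by case: (cover_val_seq w). Qed.

Lemma cover_proj_rcons (z w : cvert) u : val w = rcons (val z) u -> proj w = u.
Proof. by rewrite /cover_proj => ->; rewrite last_rcons. Qed.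

Lemma cover_projE (w : cvert) : proj w = nth vb (val w) (size (val w)).-1.
Proof. by rewrite nth_last. Qed.

Lemma cover_joined (z w : cvert) u :
  val w = rcons (val z) u -> exists e, joined e (proj z) u.
Proof.
move=> wz; have [_ _ H _] := cover_val_seq w; have z0 := cover_val_size z.
have := H (size (val z)).-1; rewrite wz size_rcons prednK // ltnSn => /(_ isT).
by rewrite !nth_rcons prednK // leqnn ltnn eqxx -cover_projE.
Qed.

Lemma cover_seq_belast s u :
  (0 < size s)%N -> cover_seq vb (rcons s u) -> cover_seq vb s.
Proof.
move=> s0 [_ H0 H1 H2]; split=> //.
- by move: H0; rewrite nth_rcons s0.
- move=> i is_; have := H1 i; rewrite size_rcons !nth_rcons is_ (ltnW is_).
  by apply; apply: ltnW.
- move=> i e f is_; have := H2 i e f; rewrite size_rcons !nth_rcons is_.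
  by rewrite (ltnW is_) (ltnW (ltnW is_)); apply; apply: ltnW.
Qed.

Lemma cover_ind (Q : cvert -> Prop) : Q (cover_base vb) ->
  (forall z w u e, val w = rcons (val z) u -> joined e (proj z) u -> Q z -> Q w) ->
  forall w, Q w.
Proof.
move=> Q0 QS w; have [n] := ubnP (size (val w)); elim: n w => // n IH w wn.
case/lastP E: (val w) => [|s u]; first by have := cover_val_size w; rewrite E.
have [s0|s0] := posnP (size s).
  have -> // : w = cover_base vb; apply: val_inj => /=.
  have [_ H0 _ _] := cover_val_seq w.
  rewrite [LHS]E (size0nil s0) /=; congr [:: _].
  by move: H0; rewrite E (size0nil s0).
have sP : `[< cover_seq vb s >].
  by apply/asboolP/(cover_seq_belast s0 (u := u)); rewrite -E; apply: cover_val_seq.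
have [e eu] := cover_joined (z := exist _ s sP) E.
apply: (QS (exist _ s sP) w u e) => //; apply: IH => /=.
by move: wn; rewrite E size_rcons.
Qed.

(** Recursion along paths, done by a left fold whose state also carries the current end point. The
    leading [vb] is dropped from the sequence since it is already in the initial state. *)
Lemma cover_rec (A : Type) (a0 : A) (f : A -> vert G -> vert G -> A) :
  exists2 st : cvert -> A, st (cover_base vb) = a0
    & forall z w u, val w = rcons (val z) u -> st w = f (st z) (proj z) u.
Proof.
pose g (p : vert G * A) u := (u, f p.2 p.1 u).
have gE z : (foldl g (vb, a0) (behead (val z))).1 = proj z.
  have [_ H0 _ _] := cover_val_seq z; have := cover_val_size z; move: H0.
  rewrite /cover_proj; case: (val z) => [//|v s] /= -> _.
  by case/lastP: s => [//|s u]; rewrite foldl_rcons last_rcons.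
exists (fun w => (foldl g (vb, a0) (behead (val w))).2) => // z w u wz.
rewrite wz -gE; have := cover_val_size z; case: (val z) => [//|v s] _ /=.
by rewrite foldl_rcons.
Qed.

Lemma cover_no_backtrack (z w w' : cvert) u u' e :
  val w = rcons (val z) u -> val w' = rcons (val w) u' ->
  joined e (proj z) u -> joined e u u' -> False.
Proof.
move=> wz w'w eu eu'; have [_ _ _ H] := cover_val_seq w'.
have pz := cover_projE z; have := cover_val_size z.
case E: (size (val z)) pz => [//|n] /= pz _.
by apply: (H n e e); rewrite // w'w wz ?size_rcons ?E // !nth_rcons
  !size_rcons E !ltnS ?leqnSn ?leqnn ?ltnn ?eqxx // -pz.
Qed.

(** The only obstruction to prolonging a path along [e] is having just arrived along [e]. *)
Lemma cover_extend (w : cvert) u e : joined e (proj w) u ->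
  (forall z, val w = rcons (val z) (proj w) -> ~ joined e (proj z) (proj w)) ->
  exists w' : cvert, val w' = rcons (val w) u.
Proof.
move=> eu nb; suff wP : `[< cover_seq vb (rcons (val w) u) >].
  by exists (exist _ (rcons (val w) u) wP).
have [s0 H0 H1 H2] := cover_val_seq w.
apply/asboolP; split.
- by rewrite size_rcons.
- by rewrite nth_rcons s0.
- move=> i; rewrite size_rcons ltnS leq_eqVlt => /orP[/eqP is_|is_].
    by exists e; rewrite !nth_rcons is_ ltnn eqxx leqnn -[i]/(i.+1.-1) is_ -cover_projE.
  by rewrite !nth_rcons is_ (ltnW is_); apply: H1.
- move=> i f g; rewrite size_rcons ltnS leq_eqVlt => /orP[/eqP is_|is_]; last first.
    by rewrite !nth_rcons is_ (ltnW is_) (ltnW (ltnW is_)); apply: H2.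
  (* The only new triple of consecutive vertices ends at [u]. A repeated edge in it must be [e],
     which would then be the last edge of [w]. *)
  rewrite !nth_rcons is_ ltnn eqxx leqnn -is_ ltnS leqnSn => fj gj fg; subst g.
  have wE : nth vb (val w) i.+1 = proj w by rewrite cover_projE -is_.
  rewrite wE in fj gj; have fe := joined_inj gj eu; subst f.
  case/lastP E: (val w) => [|s v]; first by rewrite E in s0.
  have ss : size s = i.+1 by apply: succn_inj; rewrite is_ E size_rcons.
  have sP : `[< cover_seq vb s >].
    apply/asboolP/(cover_seq_belast (u := v)); first by rewrite ss.
    by rewrite -E; apply: cover_val_seq.
  apply: (nb (exist _ s sP)) => /=; first by rewrite /cover_proj E last_rcons.
  by move: fj; rewrite E nth_rcons ss leqnn [proj (exist _ _ _)]cover_projE /= ss.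
Qed.

Local Notation hatG := (universal_cover vb).
Local Notation eproj := (@cover_eproj G vb).

Lemma cover_edge_cases (e : edge hatG) (w : vert hatG) : w \in ends e ->
  [\/ ends e = [fset w]%fset /\ half_edge (eproj e),
      exists2 w', ends e = [fset w; w']%fset
        & val w' = rcons (val w) (proj w') /\ joined (eproj e) (proj w) (proj w')
    | exists2 z, ends e = [fset z; w]%fset
        & val w = rcons (val z) (proj w) /\ joined (eproj e) (proj z) (proj w)].
Proof.
move=> we; have /asboolP := valP e.
case=> [[w0 [AE ha _]]|[z [w' [u [zw' AE ja]]]]]; have {}AE : ends e = _ := AE.
  by move: we; rewrite AE inE => /eqP->; apply: Or31.
have w'u := cover_proj_rcons zw'; move: we; rewrite AE !inE => /orP[]/eqP->.
  by apply: Or32; exists w' => //; rewrite w'u.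
by apply: Or33; exists z => //; rewrite w'u.
Qed.

Lemma cover_joined_cases (e : edge hatG) (w w' : vert hatG) : joined e w w' ->
  (val w' = rcons (val w) (proj w') /\ joined (eproj e) (proj w) (proj w')) \/
  (val w = rcons (val w') (proj w) /\ joined (eproj e) (proj w') (proj w)).
Proof.
move=> ej; have [we _] := joined_ends ej; case/andP: ej => ww' /eqP eE.
have fset2_inj (x : vert hatG) : [fset w; w']%fset = [fset w; x]%fset -> x = w'.
  move/fsetP/(_ w'); rewrite !inE eqxx orbT eq_sym (negPf ww') /=.
  by move/esym/eqP.
case: (cover_edge_cases we) => [[eE1 _]|[x eE1 H]|[z eE1 H]].
- have := cardfs1 w; rewrite -eE1 eE cardfs2 ww'; by [].
- by left; rewrite -(fset2_inj x) // -eE.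
- by right; rewrite -(fset2_inj z) // -eE eE1 fsetUC.
Qed.

Lemma cover_edge_exists A a : cover_edge_pred (vb := vb) (A, a) ->
  exists2 e : edge hatG, ends e = A & eproj e = a.
Proof. by move=> /asboolP Aa; exists (exist _ (A, a) Aa). Qed.

Lemma half_joined (e : edge G) u v : half_edge e -> joined e u v -> False.
Proof.
by move=> /eqP he /andP[uv /eqP eE]; move: he; rewrite eE cardfs2 uv.
Qed.

Lemma joined_other (e : edge G) u v v' :
  joined e u v -> joined e u v' -> v = v'.
Proof.
case/andP=> uv /eqP eE /andP[uv' /eqP eE'].
have : v \in ends e by rewrite eE !inE eqxx orbT.
by rewrite eE' !inE eq_sym (negPf uv) => /eqP.
Qed.

(** Two edges at [w] over the same edge cannot be one forward and one backward, since paths do not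
    backtrack. In the remaining cases their other ends agree. *)
Lemma cover_star_bij (w : vert hatG) :
  set_bij (incident_edges w) (incident_edges (proj w)) eproj.
Proof.
split.
- move=> e we; rewrite /incident_edges /=.
  case: (cover_edge_cases we) =>
    [[eE he]|[w' _ [_ /joined_ends[]//]]|[z _ [_ /joined_ends[]//]]].
  have /asboolP := valP e => -[[w0 [AE _]]|[z [w' [u [_ _ ja]]]]].
    by move: eE; rewrite -[ends e]/((val e).1) AE => /fset1_inj->.
  by case: (half_joined he ja).
- move=> e f; rewrite !inE => we wf ef; apply: val_inj.
  suff E : ends e = ends f.
    rewrite [val e]surjective_pairing [val f]surjective_pairing.
    by congr (_, _); [exact: E|exact: ef].
  case: (cover_edge_cases we) => [[-> he]|[w1 -> [w1E j1]]|[z1 -> [w1E j1]]];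
  case: (cover_edge_cases wf) => [[-> hf]|[w2 -> [w2E j2]]|[z2 -> [w2E j2]]] //.
  + by rewrite ef in he; case: (half_joined he j2).
  + by rewrite ef in he; case: (half_joined he j2).
  + by rewrite -ef in hf; case: (half_joined hf j1).
  + rewrite ef in j1; have pp := joined_other j1 j2.
    by congr [fset w; _]%fset; apply: val_inj; rewrite /= w1E w2E pp.
  + by rewrite ef in j1; case: (cover_no_backtrack w2E w1E j2 j1).
  + by rewrite -ef in hf; case: (half_joined hf j1).
  + by rewrite ef in j1; case: (cover_no_backtrack w1E w2E j1 j2).
  + have pp : val z1 = val z2 by move: w1E; rewrite w2E => /rcons_inj[].
    by rewrite (val_inj pp).
- move=> a wa.
  have [ha|ha] := boolP (half_edge a).
    have [|e eE <-] := @cover_edge_exists [fset w]%fset a; first by left; exists w.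
    by exists e => //; have : w \in ends e by rewrite eE inE.
  have [u ju] : exists u, joined a (proj w) u.
    have a2 : #|` ends a| = 2%N.
      by have := ends_size a; move: ha; rewrite /half_edge; case: #|` _| => [|[|[|]]].
    have /cardfs1P[u uE] : #|` ends a `\ proj w |%fset == 1%N.
      by have := cardfsD1 (proj w) (ends a); rewrite wa a2 add1n => -[<-].
    exists u; rewrite /joined; have : u \in (ends a `\ proj w)%fset by rewrite uE inE.
    rewrite !inE => /andP[uw _]; rewrite eq_sym uw /=.
    by rewrite -(fsetD1K wa) uE.
  (* A full edge lifts to the last step of [w] if [w] arrived along it, and to a one-step extension
     of [w] otherwise. *)
  have [[z [zE jz]]|nz] := pselect
    (exists z : cvert, val w = rcons (val z) (proj w) /\ joined a (proj z) (proj w)).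
    have [|e eE <-] := @cover_edge_exists [fset z; w]%fset a.
      by right; exists z, w, (proj w).
    by exists e => //; have : w \in ends e by rewrite eE !inE eqxx orbT.
  have [z zE jz|w' w'E] := cover_extend ju; first by apply: nz; exists z.
  have [|e eE <-] := @cover_edge_exists [fset w; w']%fset a.
    by right; exists w, w', u.
  by exists e => //; have : w \in ends e by rewrite eE !inE eqxx.
Qed.
End CoverTheory.

(** * Seeds on the universal cover *)

Section CoverSeeds.
Variables (R : realType) (I : finType) (B : I -> I -> int) (delta : I -> R).
Hypothesis B_skew : skew_symmetrized_by delta B.
Variables (V : vectType R) (alpha : I -> V).
Hypothesis alpha_basis : basis_of fullv [seq alpha i | i <- enum I].
Variable omega : V -> V -> R.
Hypothesis omega_bilinear : bilinear_form omega.
Hypothesis omegaE :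
  forall i j, omega (coroot delta alpha i) (alpha j) = (B i j)%:~R.
Variables (G : quasi_graph) (C Cv : vert G -> edge G -> V) (vb : vert G).
Hypothesis G_framework : framework delta alpha omega C Cv vb.
Variables (P : groupType) (oplus : P -> P -> P).
Hypothesis P_semifield : semifield oplus.
Variables (F : fieldType) (iota : P -> F).
Hypothesis F_ambient : ambient_field iota I.
Variables (Y : I -> P) (X : I -> F).
Hypothesis X_indep : alg_indep iota X.

Local Notation hatG := (universal_cover vb).
Local Notation proj := (@cover_proj G vb).
Local Notation eproj := (@cover_eproj G vb).
Local Notation S0 := (Seed B Y X).
Local Notation mu_rel := (mu_rel alpha omega C Cv).
Local Notation mutate := (mutate oplus iota).
Local Notation labeling := (labeling omega C Cv).

(** All seeds are indexed by the fixed set [I], with [lab w] translating indices into edges at the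
    image of [w], so that recursion along paths has a constant type. Only forward steps are
    imposed. *)
Record cover_seeds (lab : vert hatG -> I -> edge G)
    (T : vert hatG -> seed P F I) : Prop := CoverSeeds {
  cs_base : forall i, C vb (lab (cover_base vb) i) = alpha i;
  cs_init : T (cover_base vb) = S0;
  cs_labeling : forall w, labeling (proj w) (lab w) (seed_B (T w));
  cs_indep : forall w, alg_indep iota (seed_X (T w));
  cs_reachable : forall w, reachable oplus iota S0 (T w);
  cs_step : forall z w : vert hatG, val w = rcons (val z) (proj w) ->
    exists k, [/\ joined (lab z k) (proj z) (proj w), T w = mutate (T z) k
      & forall i, mu_rel (lab z k) (proj z) (proj w) (lab z i) (lab w i)] }.

Lemma cover_seeds_exist : exists lab T, cover_seeds lab T.
Proof.
have [lab0 lab0P] := base_labels_exist G_framework.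
(* One step mutates at the index of the edge crossed and moves each index by [mu_e]. Neither the
   [else] branch nor the default of [xget] is reached from a labeling when [u] and [u'] are
   joined. *)
pose f (st : (I -> edge G) * seed P F I) u u' :=
  if [pick k | joined (st.1 k) u u'] is Some k then
    (fun i => xget (st.1 i) [set g | mu_rel (st.1 k) u u' (st.1 i) g],
     mutate st.2 k)
  else st.
have [st st0 stS] := @cover_rec G vb _ (lab0, S0) f.
have fP lab T u u' : labeling u lab (seed_B T) ->
    (exists e, joined e u u') ->
    exists k lab', [/\ joined (lab k) u u', f (lab, T) u u' = (lab', mutate T k)
      & forall i, mu_rel (lab k) u u' (lab i) (lab' i)].
  move=> L [e eu]; rewrite /f; case: pickP => [k /= ku|none] /=.
    do 2 eexists; split=> [|//|i]; first exact: ku.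
    have [g gP] := mu_rel_exists G_framework L ku i.
    exact: (@xgetPex _ _ [set g | mu_rel (lab k) u u' (lab i) g] (ex_intro _ g gP)).
  have [k ke] := lab_surj L (joined_ends eu).1.
  by have := none k; rewrite /= ke eu.
have H (w : vert hatG) : [/\ labeling (proj w) (st w).1 (seed_B (st w).2),
    alg_indep iota (seed_X (st w).2) & reachable oplus iota S0 (st w).2].
  elim/cover_ind: w => [|z w u e wz eu [L T_indep T_reach]].
    rewrite st0; split=> //; last exact: reachable_init.
    exact: (base_labeling B_skew alpha_basis omegaE G_framework lab0P).
  rewrite (stS z w u wz) (cover_proj_rcons wz).
  have [|k [lab' []]] := fP (st z).1 (st z).2 (proj z) u L; first by exists e.
  rewrite -surjective_pairing => ku -> lab'P; split=> /=.
  - exact: (labeling_step B_skew alpha_basis omega_bilinear omegaE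
      G_framework L ku lab'P erefl).
  - apply: (mutate_alg_indep F_ambient T_indep).
    exact: (labeling_diag B_skew alpha_basis omega_bilinear omegaE G_framework k L).
  - exact: reachable_mutate.
exists (fun w => (st w).1), (fun w => (st w).2); split.
- by move=> i; rewrite st0; case: (lab0P i).
- by rewrite st0.
- by move=> w; case: (H w).
- by move=> w; case: (H w).
- by move=> w; case: (H w).
- move=> z w wz; have [L _ _] := H z.
  have [|k [lab' []]] := fP (st z).1 (st z).2 (proj z) (proj w) L.
    exact: cover_joined wz.
  rewrite -surjective_pairing -(stS z w _ wz) => ku -> lab'P.
  by exists k; split.
Qed.

Variables (lab : vert hatG -> I -> edge G) (T : vert hatG -> seed P F I).
Hypothesis cs : cover_seeds lab T.

Lemma cover_seeds_diag w k : seed_B (T w) k k = 0.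
Proof.
exact: (labeling_diag B_skew alpha_basis omega_bilinear omegaE
  G_framework k (cs_labeling cs w)).
Qed.

(** Forward steps hold by construction. A backward step uses the same index, as [mu_e] fixes [e],
    together with involutivity of mutation and [mu_rel_rev]. *)
Lemma cover_seeds_joined (e : edge hatG) (w w' : vert hatG) : joined e w w' ->
  exists k, [/\ lab w k = eproj e, T w' = mutate (T w) k
    & forall i, mu_rel (lab w k) (proj w) (proj w') (lab w i) (lab w' i)].
Proof.
case/cover_joined_cases=> -[wz ej]; have [k [kj TE mu]] := cs_step cs wz.
  by exists k; split=> //; apply: joined_inj kj ej.
have L := cs_labeling cs w'.
have kE : lab w k = lab w' k by have := mu k; rewrite /mu_rel eqxx.
exists k; split.
- by rewrite kE; apply: joined_inj kj ej.
- rewrite TE (mutate_involutive P_semifield F_ambient) //; first exact: cover_seeds_diag.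
  by rewrite -TE; apply: (cluster_neq0 F_ambient (cs_indep cs (w := w))).
- by move=> i; rewrite kE; apply: (mu_rel_rev B_skew alpha_basis omega_bilinear
    omegaE G_framework L kj mu).
Qed.

Lemma cover_star_finite (w : vert hatG) : finite_set (incident_edges w).
Proof.
have [ew inj _] := cover_star_bij w.
have fin_w : finite_set (incident_edges (proj w)).
  by exists #|I|; apply: fw_regular G_framework _.
rewrite -(eq_finite_set (inj_card_eq inj)).
by apply: sub_finite_set fin_w => _ [e we <-]; apply: ew.
Qed.

Lemma star_end (w : vert hatG) (e : star w) : w \in ends (val e).
Proof.
have := fsvalP e; rewrite in_fset_set; last exact: cover_star_finite.
by rewrite inE.
Qed.

Lemma star_index_exists (w : vert hatG) : exists2 idx : star w -> I,
  bijective idx & forall e, lab w (idx e) = eproj (val e).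
Proof.
have L := cs_labeling cs w; have [ew einj esurj] := cover_star_bij w.
have /choice[idx idxP] : forall e : star w, exists i, lab w i = eproj (val e).
  by move=> e; apply: (lab_surj L); apply: ew; apply: star_end.
exists idx => //.
have /choice[g gP] : forall i, exists e : star w, eproj (val e) = lab w i.
  move=> i; have [e we eE] := esurj _ (lab_in L i).
  have es : e \in star w by rewrite in_fset_set ?inE //; apply: cover_star_finite.
  by exists [` es]%fset.
exists g => [e|i]; last by apply: (lab_inj L); rewrite idxP gP.
apply: val_inj; apply: einj; rewrite ?inE; try exact: star_end.
by rewrite gP idxP.
Qed.

Local Notation exgraph := (exchange_graph oplus iota S0).

Lemma cover_star_joined (e : edge hatG) (w w' : vert hatG) :
  w \in ends e -> w' \in ends e -> w' = w \/ joined e w w'.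
Proof.
move=> we w'e; have [->|ww'] := eqVneq w' w; [by left|right].
rewrite /joined eq_sym ww' /=; apply/eqP/esym/eqP; rewrite eqEfcard; apply/andP; split.
  by apply/fsubsetP => x; rewrite !inE => /orP[]/eqP->.
by rewrite cardfs2 eq_sym ww'; case/andP: (ends_size e).
Qed.

Lemma reachable_unlabeled_exists S : reachable oplus iota S0 S ->
  exists c : vert exgraph, val c = unlabeled I S.
Proof.
move=> S_reach; suff cP : `[< exists2 S', reachable oplus iota S0 S' &
    unlabeled I S = unlabeled I S' >] by exists (exist _ (unlabeled I S) cP).
by apply/asboolP; exists S.
Qed.

Lemma exchange_edge_exists S k (c c' : vert exgraph) :
  reachable oplus iota S0 S -> val c = unlabeled I S ->
  val c' = unlabeled I (mutate S k) ->
  exists E : edge exgraph, ends E = [fset c; c']%fset.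
Proof.
move=> S_reach cS c'S; suff EP : `[< exch_edge_pred [fset c; c']%fset >].
  by exists (exist _ [fset c; c']%fset EP).
by apply/asboolP; exists S, k, c, c'.
Qed.

(** * The induced covering of the exchange graph *)

Section Covering.
Variable phi : vert hatG -> vert exgraph.
Hypothesis phiP : forall w, val (phi w) = unlabeled I (T w).

(** The image is built from one end [w0] of [e] and has to fit the other end too. There the mutated
    seed is [T w] itself, and mutating it along [e] returns to [T w0]. *)
Lemma cover_edge_image_exists (e : edge hatG) :
  exists E : edge exgraph, forall (w : vert hatG) k,
    w \in ends e -> lab w k = eproj e ->
    exists2 c, ends E = [fset phi w; c]%fset
      & val c = unlabeled I (mutate (T w) k).
Proof.
have [w0 w0e] : exists w0, w0 \in ends e.
  by apply/fset0Pn; rewrite -cardfs_gt0; case/andP: (ends_size e).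
have [ew _ _] := cover_star_bij w0.
have [k0 k0e] := lab_surj (cs_labeling cs w0) (ew _ w0e).
have [c0 c0E] := reachable_unlabeled_exists
  (reachable_mutate k0 (cs_reachable cs w0)).
have [E EE] := exchange_edge_exists (cs_reachable cs w0) (phiP w0) c0E.
exists E => w k we ke; case: (cover_star_joined w0e we) => [ww0|j].
  subst w; exists c0 => //; rewrite c0E; congr (unlabeled I (mutate _ _)).
  by apply: (lab_inj (cs_labeling cs w0)); rewrite ke.
have [k1 [k1e Tw _]] := cover_seeds_joined j.
have k10 : k1 = k0 by apply: (lab_inj (cs_labeling cs w0)); rewrite k0e.
have c0w : c0 = phi w by apply: val_inj; rewrite c0E phiP Tw k10.
rewrite joinedC in j; have [k2 [k2e Tw0 _]] := cover_seeds_joined j.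
have k2k : k2 = k by apply: (lab_inj (cs_labeling cs w)); rewrite ke.
exists (phi w0); first by rewrite EE c0w fsetUC.
by rewrite phiP Tw0 k2k.
Qed.

Variable psi : edge hatG -> edge exgraph.
Hypothesis psiP : forall (e : edge hatG) (w : vert hatG) k,
  w \in ends e -> lab w k = eproj e ->
  exists2 c, ends (psi e) = [fset phi w; c]%fset
    & val c = unlabeled I (mutate (T w) k).

Lemma cover_edge_index (e : edge hatG) (w : vert hatG) :
  w \in ends e -> exists k, lab w k = eproj e.
Proof.
have [ew _ _] := cover_star_bij w => we.
exact: (lab_surj (cs_labeling cs w) (ew _ we)).
Qed.

Lemma mutate_vertex_neq w k (c : vert exgraph) :
  val c = unlabeled I (mutate (T w) k) -> c != phi w.
Proof.
move=> cE; apply/eqP => cw; move: cE; rewrite cw phiP => /esym.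
exact: (unlabeled_mutate_neq F_ambient (@cover_seeds_diag w) (cs_indep cs (w := w))).
Qed.

Lemma cover_exchange_covering : covering phi psi.
Proof.
split.
- move=> e w w' j; have [we _] := joined_ends j.
  have [k [ke Tw' _]] := cover_seeds_joined j.
  have [c cE cT] := psiP we ke.
  have cw' : c = phi w' by apply: val_inj; rewrite cT phiP Tw'.
  by rewrite /joined eq_sym -cw' (mutate_vertex_neq cT) cE eqxx.
- move=> w; have [ew einj esurj] := cover_star_bij w; split.
  + move=> e we; have [k ke] := cover_edge_index we.
    have [c cE _] := psiP we ke.
    suff: phi w \in ends (psi e) by [].
    by rewrite cE !inE eqxx.
  + move=> e f; rewrite !inE => we wf ef.
    have [k ke] := cover_edge_index we; have [l lf] := cover_edge_index wf.
    have [c cE cT] := psiP we ke; have [d dE dT] := psiP wf lf.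
    apply: einj; rewrite ?inE // -ke -lf; congr (lab w _).
    apply: (unlabeled_mutate_inj (oplus := oplus) F_ambient (@cover_seeds_diag w)
      (cs_indep cs (w := w))).
    rewrite -[LHS]cT -[RHS]dT; congr (val _).
    (* Both image edges contain [phi w]. As mutation changes the unlabeled seed, their other ends
       must agree. *)
    have : c \in ends (psi f) by rewrite -ef cE !inE eqxx orbT.
    by rewrite dE !inE (negPf (mutate_vertex_neq cT)) => /eqP.
  + move=> E wE.
    have [k [c [cT EE]]] := exchange_edge_mutate P_semifield F_ambient
      (@cover_seeds_diag w) (cs_indep cs (w := w)) (phiP w) wE.
    have [e we eE] := esurj _ (lab_in (cs_labeling cs w) k).
    exists e => //; have [d dE dT] := psiP we (esym eE).
    have dc : d = c by apply: val_inj; rewrite dT cT.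
    suff eE' : ends (psi e) = ends E by apply: val_inj; exact: eE'.
    by rewrite dE EE dc.
- move=> full x; have /asboolP[S S_reach xS] := valP x.
  suff [w [m mT]] : exists w m, transported m (T w) S.
    by exists w; apply: val_inj; rewrite phiP [RHS]xS; apply: unlabeled_transported mT.
  (* A mutation sequence lifts step by step: the edge over each direction is full, so it leads to
     another vertex of the cover. *)
  elim: S_reach => [|S' k _ [w [m mT]]].
    by exists (cover_base vb), id; rewrite (cs_init cs); apply: transported_id.
  case: (mT) => -[m' mK m'K] _ _ _.
  have [_ _ esurj] := cover_star_bij w.
  have [e we eE] := esurj _ (lab_in (cs_labeling cs w) (m' k)).
  have [w' j] : exists w', joined e w w'.
    have /cardfs1P[w' w'E] : #|` ends e `\ w |%fset == 1%N.
      have := cardfsD1 w (ends e); rewrite (eqP (full e)) we add1n.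
      by move=> /succn_inj <-.
    have : w' \in (ends e `\ w)%fset by rewrite w'E inE.
    rewrite !inE => /andP[w'w w'e]; exists w'.
    by case: (cover_star_joined we w'e) => // w'w0; rewrite w'w0 eqxx in w'w.
  have [k1 [k1e Tw' _]] := cover_seeds_joined j.
  have k1E : k1 = m' k by apply: (lab_inj (cs_labeling cs w)); rewrite k1e eE.
  exists w', m; rewrite Tw' k1E -{2}(m'K k).
  exact: transported_mutate mT.
Qed.
End Covering.
End CoverSeeds.

Theorem theorem3p23
  (R : realType) (I : finType) (B : I -> I -> int) (delta : I -> R)
  (B_skew : skew_symmetrized_by delta B)
  (V : vectType R) (alpha : I -> V)
  (alpha_basis : basis_of fullv [seq alpha i | i <- enum I])
  (omega : V -> V -> R) (omega_bilinear : bilinear_form omega)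
  (omegaE : forall i j, omega (coroot delta alpha i) (alpha j) = (B i j)%:~R)
  (G : quasi_graph) (C Cv : vert G -> edge G -> V) (vb : vert G)
  (G_framework : framework delta alpha omega C Cv vb)
  (P : groupType) (oplus : P -> P -> P) (P_semifield : semifield oplus)
  (F : fieldType) (iota : P -> F) (F_ambient : ambient_field iota I)
  (Y : I -> P) (X : I -> F) (X_indep : alg_indep iota X) :
  let hatG := universal_cover vb in
  let base : vert hatG := cover_base vb in
  let S0 := Seed B Y X in
  exists SeedOf : forall w : vert hatG, seed P F (star w),
    [/\ (forall w : vert hatG, is_seed R iota (SeedOf w)),

        (exists2 m : star base -> I,
           (forall e : star base, C vb (cover_eproj (val e)) = alpha (m e))
           & transported m (SeedOf base) S0),

        (forall (w w' : vert hatG) (e : star w), joined (val e) w w' ->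
           exists2 m : star w -> star w',
             (forall f : star w,
                mu_rel alpha omega C Cv (cover_eproj (val e))
                  (cover_proj w) (cover_proj w')
                  (cover_eproj (val f)) (cover_eproj (val (m f))))
             & transported m (mutate oplus iota (SeedOf w) e) (SeedOf w')),

        (exists (phi : vert hatG -> vert (exchange_graph oplus iota S0))
                (psi : edge hatG -> edge (exchange_graph oplus iota S0)),
           [/\ (forall w, val (phi w) = unlabeled I (SeedOf w)),
               (forall w (e : star w),
                  exists2 c, c \in ends (psi (val e))
                    & val c = unlabeled I (mutate oplus iota (SeedOf w) e))
             & covering phi psi])

      & (forall (w : vert hatG) (e f : star w),
           (seed_B (SeedOf w) e f)%:~R =
           omega (Cv (cover_proj w) (cover_eproj (val e)))
                 (C (cover_proj w) (cover_eproj (val f))))].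
Proof.
move=> hatG base S0.
have [lab [T cs]] := cover_seeds_exist B_skew alpha_basis omega_bilinear omegaE
  G_framework oplus F_ambient Y X_indep.
have idx_ex w := star_index_exists G_framework cs w.
(* The type of the index map depends on [w], so the maps are chosen pointwise as a dependent
   function. *)
have [idx idxP] : exists idx : forall w : vert hatG, star w -> I,
    forall w, bijective (idx w) /\
      forall e, lab w (idx w e) = cover_eproj (val e).
  exists (fun w => s2val (cid2 (idx_ex w))) => w.
  by case: (cid2 (idx_ex w)).
have idx_bij w : bijective (idx w) by case: (idxP w).
have idxE w e : lab w (idx w e) = cover_eproj (val e) by case: (idxP w).
pose SeedOf w : seed P F (star w) :=
  Seed (fun e f => seed_B (T w) (idx w e) (idx w f))
       (fun e => seed_Y (T w) (idx w e)) (fun e => seed_X (T w) (idx w e)).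
have ST w : transported (idx w) (SeedOf w) (T w) by split=> //; apply: idx_bij.
have L w := cs_labeling cs w.
have unl w : unlabeled I (SeedOf w) = unlabeled I (T w).
  exact: unlabeled_transported (ST w).
exists SeedOf; split.
- move=> w; split; last first.
    apply: (transported_alg_indep (iota1 F_ambient) (iotaM F_ambient) (ST w)).
    exact: (cs_indep cs (w := w)).
  have [d [d0 dB]] := labeling_skew B_skew alpha_basis omega_bilinear omegaE
    G_framework (L w).
  by exists (d \o idx w); split=> *; [apply: d0|apply: dB].
- exists (idx base); last by rewrite /S0 -(cs_init cs); apply: ST.
  by move=> e; rewrite -idxE (cs_base cs).
- move=> w w' e j; have [k [ke Tw' mu]] := cover_seeds_joined B_skew alpha_basis
    omega_bilinear omegaE G_framework P_semifield F_ambient cs j.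
  have kE : k = idx w e by apply: (lab_inj (L w)); rewrite ke idxE.
  have [g gK idxK] := idx_bij w'.
  (* The index set [I] mediates: edges at [w] and [w'] with the same index correspond under
     [mu_e]. *)
  exists (g \o idx w).
    by move=> f; rewrite -!idxE /= idxK -kE; apply: mu.
  apply: (transported_comp (T := T w')).
    by rewrite Tw' kE; apply: transported_mutate (ST w).
  exact: transported_inv (ST w').
- have /choice[phi phiP] : forall w : vert hatG,
      exists c : vert (exchange_graph oplus iota S0), val c = unlabeled I (T w).
    by move=> w; apply: reachable_unlabeled_exists; apply: cs_reachable cs _.
  have /choice[psi psiP] := cover_edge_image_exists B_skew alpha_basis
    omega_bilinear omegaE G_framework P_semifield F_ambient cs phiP.
  exists phi, psi; split.
  + by move=> w; rewrite phiP unl.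
  + move=> w e; have [c cE cT] := psiP (val e) w (idx w e)
      (star_end G_framework e) (idxE w e).
    exists c; first by rewrite cE !inE eqxx orbT.
    by rewrite cT; apply/esym/unlabeled_transported/transported_mutate/ST.
  + exact: (cover_exchange_covering B_skew alpha_basis
      omega_bilinear omegaE G_framework P_semifield F_ambient cs phiP psiP).
- by move=> w e f; rewrite /= (labB (L w)) !idxE.
Qed.
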